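(* Let $\Gamma$ be as in the context. For $z,\tau\in\mathbb{H}$ with $z_2>\mathrm{Im}(\gamma\tau)$ for all $\gamma\in\Gamma$, $$\mathcal F_2(z,\tau)=\sum_{\gamma\in\Gamma_\infty\backslash\Gamma}\left(\frac{e^{2\pi i(z-\gamma\tau)}}{1-e^{2\pi i(z-\gamma\tau)}}+\frac{e^{2\pi i(z-\overline{\gamma\tau})}}{1-e^{2\pi i(z-\overline{\gamma\tau})}}+\frac{\mathrm{Log}\big(1-e^{2\pi i(z-\overline{\gamma\tau})}\big)-\mathrm{Log}\big(1-e^{2\pi i(z-\gamma\tau)}\big)}{\pi i(\overline{\gamma\tau}-\gamma\tau)}\right),$$ where $\mathrm{Log}$ is the principal branch of the logarithm.
   Context: $\Gamma\subset\mathrm{PSL}_2(\mathbb{R})$ is a Fuchsian group of the first kind with a cusp $i\infty$ of width one, i.e. its stabilizer $\Gamma_\infty$ is generated by $\begin{psmallmatrix}1&1\\0&1\end{psmallmatrix}$. For $m\in\mathbb{Z}\setminus\{0\}$ and $\mathrm{Re}(s)>1$, $F_{m,s}(\tau):=\sum_{\gamma\in\Gamma_\infty\backslash\Gamma}\sqrt{\mathrm{Im}(\gamma\tau)}\,I_{s-\frac12}(2\pi|m|\mathrm{Im}(\gamma\tau))e^{2\pi i m\mathrm{Re}(\gamma\tau)}$, with $I_\kappa$ the modified Bessel function. $\mathcal F_s(z,\tau):=2\pi\sum_{n\ge1}\sqrt n\,F_{-n,s}(\tau)e^{2\pi i n z}$; in particular $\mathcal F_2$ is this series at $s=2$.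
   Formalization: The sign of the Log term is corrected: its denominator is πi(γτ − conj(γτ)) instead of πi(conj(γτ) − γτ); with the printed sign the summands do not tend to 0 and the series over the cosets diverges. *)

(* Defs.v *)
From HB Require Import structures.
From mathcomp Require Import all_boot all_order all_algebra.
From mathcomp Require Import complex.
From mathcomp Require Import all_classical all_reals all_analysis.
From mathcomp Require summability.

Set Implicit Arguments.
Unset Strict Implicit.
Unset Printing Implicit Defensive.
Set Warnings "-redundant-canonical-projection".

Import Order.TTheory GRing.Theory Num.Theory.
Import numFieldNormedType.Exports.

Local Open Scope classical_set_scope.
Local Open Scope complex_scope.
Local Open Scope ring_scope.

(* The topology of R[i] as a normed field. *)
HB.instance Definition _ (R : rcfType) := NormedModule.copy R[i] R[i]^o.

Definition cexp (R : realType) (w : R[i]) : R[i] :=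
  (expR (complex.Re w))%:C * (cos (complex.Im w) +i* sin (complex.Im w)).

(* The argument in ]-pi, pi]. *)
Definition carg (R : realType) (w : R[i]) : R :=
  let a := acos (complex.Re w / Normc.normc w) in
  if 0 <= complex.Im w then a else - a.

(* Principal branch; the value at 0 is meaningless. *)
Definition cLog (R : realType) (w : R[i]) : R[i] := ln (Normc.normc w) +i* carg w.

(* x ^ w for a real x > 0. *)
Definition cpowR (R : realType) (x : R) (w : R[i]) : R[i] :=
  cexp ((ln x)%:C * w).

(* Euler's integral, so meaningful only for 0 < Re w. *)
Definition cGamma (R : realType) (w : R[i]) : R[i] :=
  let f (t : R) : R[i] := cpowR t (w - 1) * (expR (- t))%:C in
  \int[lebesgue_measure]_(t in `]0, +oo[) complex.Re (f t)
  +i* \int[lebesgue_measure]_(t in `]0, +oo[) complex.Im (f t).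

(* The modified Bessel function of the first kind I_kappa(x), for x > 0 and,
   because of [cGamma], 0 < Re kappa + 1. *)
Definition besselI (R : realType) (kappa : R[i]) (x : R) : R[i] :=
  limn (series (fun k : nat =>
    cpowR (x / 2) (kappa + (2 * k)%N%:R) /
    (k`!%:R * cGamma (kappa + k.+1%:R)) : R[i])).

Definition moebius (R : realType) (g : 'M[R]_2) (tau : R[i]) : R[i] :=
  ((g 0 0)%:C * tau + (g 0 1)%:C) / ((g 1 0)%:C * tau + (g 1 1)%:C).

(* A subgroup of PSL_2(R) is represented by its full preimage in SL_2(R), that
   is, by a subgroup of SL_2(R) that contains -1. *)
Definition PSL2_subgroup (R : realType) (G : set 'M[R]_2) : Prop :=
  [/\ forall g, G g -> \det g = 1,
      G (- 1),
      forall g h, G g -> G h -> G (g * h)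
    & forall g, G g -> G (g^-1)].

Definition fuchsian (R : realType) (G : set 'M[R]_2) : Prop :=
  PSL2_subgroup G /\ G `<=` isolated G.

Definition orbit_of (R : realType) (G : set 'M[R]_2) (tau : R[i]) :
  set R[i] := [set moebius g tau | g in G].

(* First kind: the limit set is the whole boundary, the real line together with
   i oo, of the upper half-plane.  An orbit accumulates at i oo in the Riemann
   sphere exactly when it is unbounded. *)
Definition first_kind (R : realType) (G : set 'M[R]_2) : Prop :=
  (forall x : R, exists2 tau : R[i],
     0 < complex.Im tau & limit_point (orbit_of G tau) x%:C) /\
  (exists2 tau : R[i], 0 < complex.Im tau &
     forall M : R, exists2 w, orbit_of G tau w & M < Normc.normc w).

(* g fixes i oo iff its lower left entry vanishes. *)
Definition stab_oo (R : realType) (G : set 'M[R]_2) : set 'M[R]_2 :=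
  [set g | G g /\ g 1 0 = 0].

Definition transl (R : realType) : 'M[R]_2 :=
  \matrix_(i, j) ((i <= j)%N)%:R.

(* The sign is there because -1 is the identity of PSL_2(R). *)
Definition cusp_oo_width1 (R : realType) (G : set 'M[R]_2) : Prop :=
  stab_oo G =
  [set g | exists k : int, g = transl R ^ k \/ g = - transl R ^ k].

(* The elements of the quotient of G on the left by the stabilizer of i oo. *)
Definition cosets_oo (R : realType) (G : set 'M[R]_2) : set (set 'M[R]_2) :=
  [set [set h * g | h in stab_oo G] | g in G].

(* Unordered sums over [cosets_oo G], as limits along the finite subsets.  The
   summand is evaluated at a chosen representative, so this is meaningful for
   an f that is constant on each coset. *)
Definition on_cosets (R : realType) (G : set 'M[R]_2) (f : 'M[R]_2 -> R[i])
  (c : set_type (cosets_oo G)) : R[i] := f (get (val c)).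

Definition coset_summable (R : realType) (G : set 'M[R]_2)
    (f : 'M[R]_2 -> R[i]) : Prop :=
  cvg (summability.partial_sum (on_cosets (G := G) f) @ summability.totally).

Definition coset_sum (R : realType) (G : set 'M[R]_2)
    (f : 'M[R]_2 -> R[i]) : R[i] :=
  lim (summability.partial_sum (on_cosets (G := G) f) @ summability.totally).

(* exp(2 pi i w) *)
Definition e2pi (R : realType) (w : R[i]) : R[i] := cexp ((2 * pi)*i * w).

Definition niebur_term (R : realType) (m : int) (s tau : R[i]) (g : 'M[R]_2) :
    R[i] :=
  (Num.sqrt (complex.Im (moebius g tau)))%:C
  * besselI (s - 2^-1) (2 * pi * `|m|%:~R * complex.Im (moebius g tau))
  * e2pi (m%:~R * (complex.Re (moebius g tau))%:C).

Definition niebur (R : realType) (G : set 'M[R]_2) (m : int) (s tau : R[i]) :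
  R[i] := coset_sum G (niebur_term m s tau).

Definition calF_term (R : realType) (G : set 'M[R]_2) (s z tau : R[i])
    (n : nat) : R[i] :=
  (Num.sqrt (n%:R : R))%:C * niebur G (- n%:Z) s tau * e2pi (n%:R * z).

Definition calF (R : realType) (G : set 'M[R]_2) (s z tau : R[i]) : R[i] :=
  (2 * pi)%:C * limn (fun N => \sum_(1 <= n < N) calF_term G s z tau n).

(* The denominator pi i (w - conj w) equals - 2 pi Im w.  With this sign the
   three fractions cancel to first order as Im w tends to 0; with the opposite
   sign the sum over w = g tau diverges. *)
Definition rhs_term (R : realType) (z w : R[i]) : R[i] :=
  e2pi (z - w) / (1 - e2pi (z - w))
  + e2pi (z - w^*%C) / (1 - e2pi (z - w^*%C))
  + (cLog (1 - e2pi (z - w^*%C)) - cLog (1 - e2pi (z - w)))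
    / (pi*i * (w - w^*%C)).

(* Main.v *)
(* For a single point w = x + i y of the orbit the sum over n is elementary,
   because I_{3/2}(t) = sqrt(2/(pi t)) (cosh t - sinh t / t): with q = e(z - w)
   and q' = e(z - conj w) it equals the sum of
   q^n + q'^n - (q^n - q'^n) / (2 pi n y), that is, two geometric series and two
   logarithmic ones.  The sums over n and over the orbit may be exchanged because
   the n-th term is O(n^2 exp(- 2 pi n (Im z - y)) y^2), where y stays away from
   Im z and the sum of the y^2 over the orbit converges.  For the latter,
   Shimizu's lemma shows that the bottom rows of representatives of different
   cosets span parallelograms of area at least 1; hence the slopes of these rows,
   with y comparable to the inverse square of their length, are so separated that
   disjoint rectangles of area comparable to y^2 fit into a bounded region. *)
Require Import Defs.
From mathcomp Require Import all_boot all_order all_algebra.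
From mathcomp Require Import complex finmap.
From mathcomp Require Import all_classical all_reals all_analysis.
From mathcomp Require Import zify ring lra.
Import Order.TTheory GRing.Theory Num.Theory.
Import numFieldNormedType.Exports.
Import Normc.
Local Open Scope classical_set_scope.
Local Open Scope complex_scope.
Local Open Scope ring_scope.

Set Implicit Arguments.
Unset Strict Implicit.
Unset Printing Implicit Defensive.

(** * Limits and unordered sums of complex numbers *)

(** What permits the exchange is a majorant in product form: a factor depending only on n times
    y_c^2, where y_c is the height at the coset c. This requires a single Y < Im z above all
    heights, whereas the hypothesis gives only y_c < Im z for each c. The convergence of the sum of
    the y_c^2 supplies this uniformity too, since it leaves only finitely many heights above Im z /
    2. The factor y_c^2 itself comes from the cancellation of the constant terms of cosh t and sinh
    t / t. Two complex-analytic facts are reduced to real analysis. Gamma is given by Euler's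
    integral, so its half-integer values are drawn from the Gauss integral by a substitution and
    integration by parts. The logarithmic series is followed along the segment from 0 to q, where 1
    - s q stays in the right half-plane; there the principal logarithm has a real logarithm and an
    arctangent as its components, and the mean value theorem bounds the remainder. *)

Lemma normcD_le (R : rcfType) (x y : R[i]) : normc (x + y) <= normc x + normc y.
Proof. exact: le_normcD. Qed.

Lemma normc_ge0 (R : rcfType) (x : R[i]) : 0 <= normc x.
Proof. by case: x => a b; rewrite /normc sqrtr_ge0. Qed.

Lemma normc_real (R : rcfType) (x : R) : normc x%:C = `|x|.
Proof. by rewrite /normc /= expr0n addr0 sqrtr_sqr. Qed.

Lemma normc_sum (R : rcfType) (I : Type) (r : seq I) (P : pred I) (f : I -> R[i]) :
  normc (\sum_(i <- r | P i) f i) <= \sum_(i <- r | P i) normc (f i).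
Proof.
elim/big_ind2: _ => //; first by rewrite normc0.
by move=> a x b y xa yb; apply: (le_trans (normcD_le _ _)); exact: lerD.
Qed.

Lemma normcX (R : rcfType) (x : R[i]) n : normc (x ^+ n) = normc x ^+ n.
Proof. by elim: n => [|n IH]; rewrite ?expr0 ?normc1// !exprS normcM IH. Qed.

Lemma normc_ge_Re (R : rcfType) (x : R[i]) : `|complex.Re x| <= normc x.
Proof.
by case: x => a b /=; rewrite -sqrtr_sqr ler_sqrt ?lerDl ?sqr_ge0// addr_ge0 ?sqr_ge0.
Qed.

Lemma normc_ge_Im (R : rcfType) (x : R[i]) : `|complex.Im x| <= normc x.
Proof.
by case: x => a b /=; rewrite -sqrtr_sqr ler_sqrt ?lerDr ?sqr_ge0// addr_ge0 ?sqr_ge0.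
Qed.

Lemma normc_le_ReIm (R : rcfType) (x : R[i]) :
  normc x <= `|complex.Re x| + `|complex.Im x|.
Proof.
case: x => a b /=; rewrite -[leRHS]ger0_norm ?addr_ge0// -[leRHS]sqrtr_sqr.
rewrite ler_sqrt ?sqr_ge0// sqrrD !real_normK ?num_real//.
by rewrite addrAC lerDl mulrn_wge0// mulr_ge0.
Qed.

Lemma cvgC_normcP (R : realType) (T : Type) (F : set_system T) {FF : Filter F}
    (f : T -> R[i]) (l : R[i]) :
  f @ F --> l <-> forall e : R, 0 < e -> \forall x \near F, normc (l - f x) < e.
Proof.
split => [/cvgrPdist_lt fl e e0|fl].
  have /fl : 0 < e%:C by rewrite ltcR.
  by apply: filterS => x; rewrite /Num.norm/= ltcR.
apply/cvgrPdist_lt => e; rewrite ltcE => /andP[/eqP/= Ie e0].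
near=> x; rewrite [e]complexE Ie mulr0 addr0 /Num.norm/= ltcR.
by near: x; exact: fl.
Unshelve. all: by end_near. Qed.

Lemma cvgC_complex (R : realType) (T : Type) (F : set_system T) {FF : Filter F}
    (f g : T -> R) (a b : R) :
  f @ F --> a -> g @ F --> b -> (fun x => f x +i* g x) @ F --> (a +i* b : R[i]).
Proof.
move=> /cvgrPdist_lt fa /cvgrPdist_lt gb; apply/cvgC_normcP => e e0.
have e2 : 0 < e / 2 by rewrite divr_gt0.
near=> x; apply: (le_lt_trans (normc_le_ReIm _)) => /=.
rewrite (splitr e) ltrD//; near: x; [exact: fa|exact: gb].
Unshelve. all: by end_near. Qed.

Lemma cvgC_real (R : realType) (T : Type) (F : set_system T) {FF : Filter F}
    (f : T -> R) (a : R) :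
  f @ F --> a -> (fun x => (f x)%:C) @ F --> (a%:C : R[i]).
Proof. by move=> fa; apply: cvgC_complex => //; exact: cvg_cst. Qed.

Lemma cvgC_normc_le (R : realType) (T : Type) (F : set_system T) {FF : ProperFilter F}
    (f : T -> R[i]) (l : R[i]) (c : R) :
  f @ F --> l -> (\forall x \near F, normc (f x) <= c) -> normc l <= c.
Proof.
move=> /cvgC_normcP fl fc; apply/ler_addgt0Pr => e e0.
have [x [xc xl]] := filter_ex (filterI fc (fl e e0)).
rewrite -(subrK (f x) l) (le_trans (normcD_le _ _))// addrC.
by rewrite lerD// ltW.
Qed.

Lemma cvgCZ (R : realType) (T : Type) (F : set_system T) {FF : Filter F}
    (f : T -> R[i]) (c l : R[i]) :
  f @ F --> l -> (fun x => c * f x) @ F --> c * l.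
Proof.
move=> /cvgC_normcP fl; apply/cvgC_normcP => e e0.
have c0 : 0 < normc c + 1 by rewrite ltr_wpDl ?normc_ge0.
have := fl (e / (normc c + 1)); rewrite divr_gt0// => /(_ isT).
apply: filterS => x; rewrite ltr_pdivlMr// -mulrBr normcM => h.
apply: le_lt_trans h; rewrite mulrC ler_wpM2l ?normc_ge0//.
by rewrite lerDl.
Qed.

Lemma cvgCD (R : realType) (T : Type) (F : set_system T) {FF : Filter F}
    (f g : T -> R[i]) (l m : R[i]) :
  f @ F --> l -> g @ F --> m -> (fun x => f x + g x) @ F --> l + m.
Proof.
move=> /cvgC_normcP fl /cvgC_normcP gm; apply/cvgC_normcP => e e0.
have e2 : 0 < e / 2 by rewrite divr_gt0.
near=> x; rewrite opprD addrACA (le_lt_trans (normcD_le _ _))//.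
rewrite (splitr e) ltrD//; near: x; [exact: fl|exact: gm].
Unshelve. all: by end_near. Qed.

Lemma cvgC_sum (R : realType) (T J : Type) (F : set_system T) {FF : Filter F}
    (r : seq J) (f : J -> T -> R[i]) (l : J -> R[i]) :
  (forall j, f j @ F --> l j) ->
  (fun x => \sum_(j <- r) f j x) @ F --> \sum_(j <- r) l j.
Proof.
move=> fl; elim: r => [|j r IH].
  rewrite big_nil (_ : (fun _ => _) = fun=> 0); first exact: cvg_cst.
  by apply/funext => x; rewrite big_nil.
rewrite big_cons (_ : (fun _ => _) = fun x => f j x + \sum_(i <- r) f i x).
  exact: (cvgCD (fl j) IH).
by apply/funext => x; rewrite big_cons.
Qed.

Lemma cvgC_lim (R : realType) (T : Type) (F : set_system T) {FF : ProperFilter F}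
    (f : T -> R[i]) (l : R[i]) : f @ F --> l -> lim (f @ F) = l.
Proof. exact: (@cvg_lim (R[i] : normedModType R[i]) (@norm_hausdorff _ _)). Qed.

Section unordered_sums.
Context (R : realType) (I : choiceType).
Local Notation partial_sum := summability.partial_sum.
Local Notation totally := (@summability.totally I).
Implicit Types A : {fset I}.

#[local] Instance totally_proper : ProperFilter totally.
Proof. exact: summability.totally_filter. Qed.

Lemma partial_sumE (V : zmodType) (f : I -> V) A :
  partial_sum f A = \sum_(i <- A) f i.
Proof. by rewrite big_seq_fsetE. Qed.

Lemma totallyW A : totally [set B | (A `<=` B)%fset].
Proof. by exists A. Qed.

Lemma cvg_partial_sum_ge0 (g : I -> R) (C : R) : (forall i, 0 <= g i) ->
  (forall A, \sum_(i <- A) g i <= C) -> cvg (partial_sum g @ totally).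
Proof.
move=> g0 gC.
have hs : has_sup (range (partial_sum g)).
  split; first by exists (partial_sum g fset0), fset0.
  by exists C => _ [A _ <-]; rewrite partial_sumE.
apply/cvg_ex; exists (sup (range (partial_sum g))).
apply/cvgrPdist_lt => e e0.
have [_ [A _ <-] hA] := sup_adherent e0 hs.
near=> B.
have AB : (A `<=` B)%fset by near: B; exact: totallyW.
rewrite ger0_norm ?subr_ge0; last first.
  by apply: ub_le_sup => //; case: hs.
rewrite ltrBlDr -ltrBlDl (lt_le_trans hA)// !partial_sumE.
rewrite (big_fsetID _ [pred x | x \in A] B)/= addrC.
have -> : [fset x | x in B & x \in A]%fset = A.
  apply/fsetP => x; rewrite !inE/= andbC.
  by case: (boolP (x \in A)) => //= /(fsubsetP AB) ->.
by rewrite lerDr sumr_ge0.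
Unshelve. all: by end_near. Qed.

(** A real h with |h| <= |f| is the difference of the nonnegative functions |h| + h and |h|, whose
    finite sums are bounded; this applies to the real and imaginary parts of f. *)
Lemma cvg_partial_sumC (f : I -> R[i]) (C : R) :
  (forall A, \sum_(i <- A) normc (f i) <= C) ->
  cvg (partial_sum f @ totally).
Proof.
move=> fC.
have key (h : I -> R) : (forall i, `|h i| <= normc (f i)) ->
    cvg (partial_sum h @ totally).
  move=> hf.
  have c1 : cvg (partial_sum (fun i => `|h i|) @ totally).
    apply: (@cvg_partial_sum_ge0 _ C) => // A.
    by apply: le_trans (fC A); apply: ler_sum => i _; exact: hf.
  have c2 : cvg (partial_sum (fun i => `|h i| + h i) @ totally).
    apply: (@cvg_partial_sum_ge0 _ (C + C)) => [i|A].
      by rewrite -lerBlDr sub0r -normrN ler_norm.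
    apply: (@le_trans _ _ (\sum_(i <- A) (normc (f i) + normc (f i)))).
      by apply: ler_sum => i _; rewrite lerD// (le_trans (ler_norm _)).
    by rewrite big_split/= lerD.
  rewrite (_ : partial_sum h = partial_sum (fun i => `|h i| + h i) -
    partial_sum (fun i => `|h i|)); first exact: is_cvgB.
  apply/funext => A; rewrite [RHS]/= /GRing.add/= /GRing.opp/= !partial_sumE.
  by rewrite -sumrB; apply: eq_bigr => i _; rewrite addrC addKr.
have /cvg_ex[a cR] := key (fun i => complex.Re (f i)) (fun i => normc_ge_Re _).
have /cvg_ex[b cI] := key (fun i => complex.Im (f i)) (fun i => normc_ge_Im _).
apply/cvg_ex; exists (a +i* b).
suff -> : partial_sum f = fun A => partial_sum (fun i => complex.Re (f i)) A
    +i* partial_sum (fun i => complex.Im (f i)) A by exact: cvgC_complex.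
apply/funext => A; rewrite !partial_sumE.
elim/big_rec3: _ => [//|i x y w _ ->].
by case: (f i).
Qed.

Lemma normc_lim_partial_sum (f : I -> R[i]) (C : R) :
  (forall A, \sum_(i <- A) normc (f i) <= C) ->
  normc (lim (partial_sum f @ totally)) <= C.
Proof.
move=> fC; apply: (@cvgC_normc_le R _ totally _ (partial_sum f)).
  exact: (cvg_partial_sumC fC).
by apply: nearW => A; rewrite partial_sumE (le_trans (normc_sum _ _ _)).
Qed.

Lemma cvg_partial_sumZ (f : I -> R[i]) (c : R[i]) :
  cvg (partial_sum f @ totally) ->
  partial_sum (fun i => c * f i) @ totally --> c * lim (partial_sum f @ totally).
Proof.
move=> cf.
rewrite (_ : partial_sum _ = fun A => c * partial_sum f A).
  exact: cvgCZ.
by apply/funext => A; rewrite !partial_sumE mulr_sumr.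
Qed.

Lemma lim_partial_sumZ (f : I -> R[i]) (c : R[i]) :
  cvg (partial_sum f @ totally) ->
  lim (partial_sum (fun i => c * f i) @ totally) = c * lim (partial_sum f @ totally).
Proof. by move=> cf; apply: cvgC_lim; exact: cvg_partial_sumZ. Qed.

(** * Exchange of a series with an unordered sum under a product bound *)

Section exchange.
Variables (a : nat -> I -> R[i]) (b : nat -> R) (e : I -> R) (s : I -> R[i]).
Variables (B E : R).
Hypotheses (b0 : forall n, 0 <= b n) (e0 : forall i, 0 <= e i).
Hypothesis ab : forall n i, normc (a n i) <= b n * e i.
Hypothesis bB : forall N, \sum_(1 <= n < N) b n <= B.
Hypothesis eE : forall A, \sum_(i <- A) e i <= E.
Hypothesis as_ : forall i, (fun N => \sum_(1 <= n < N) a n i) @ \oo --> s i.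

Let P N := \sum_(1 <= n < N) b n.

Let P_le N M : (N <= M)%N -> P N <= P M.
Proof.
move=> NM; case: N NM => [|N] NM.
  by rewrite {1}/P big_geq// sumr_ge0.
by rewrite /P (@big_cat_nat _ _ _ N.+1 1 M) //= lerDl sumr_ge0.
Qed.

Let cP : cvgn P.
Proof.
apply: nondecreasing_is_cvgn; first by move=> n m; exact: P_le.
by exists B => _ [N _ <-]; exact: bB.
Qed.

Let P_lim N : P N <= limn P.
Proof.
apply: limr_ge; first exact: cP.
by exists N => // M /= NM; exact: P_le.
Qed.

Let P_sub_ge0 N : 0 <= limn P - P N.
Proof. by rewrite subr_ge0. Qed.

(** The Weierstrass test, kept quantitative: the remainder retains the factor [e i], so that it can
    still be summed over i. *)
Let tail N i : normc (s i - \sum_(1 <= n < N) a n i) <= (limn P - P N) * e i.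
Proof.
apply: (@cvgC_normc_le R _ \oo _
  (fun M => \sum_(1 <= n < M) a n i - \sum_(1 <= n < N) a n i)).
  by apply: cvgB; [exact: as_|exact: cvg_cst].
exists (N.+1) => // M /= NM.
have -> : \sum_(1 <= n < M) a n i - \sum_(1 <= n < N) a n i =
    \sum_(maxn 1 N <= n < M) a n i.
  (* The sums start at 1, so they are empty for N = 0 as well as for N = 1; hence the lower bound
     [maxn 1 N]. *)
  case: N NM => [|N] NM; first by rewrite [X in _ - X]big_geq// subr0.
  rewrite (@big_cat_nat _ _ _ N.+1 1 M)//= ?(ltnW NM)//.
  by rewrite addrAC subrr add0r (maxn_idPr _).
apply: (le_trans (normc_sum _ _ _)).
apply: (@le_trans _ _ (\sum_(maxn 1 N <= n < M) b n * e i)).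
  exact: ler_sum.
rewrite -mulr_suml ler_wpM2r// lerBrDr.
apply: le_trans (P_lim M); case: N NM => [|N] NM.
  by rewrite {1}/P [X in _ + X]big_geq// addr0.
by rewrite /P (@big_cat_nat _ _ _ N.+1 1 M)//= ?(ltnW NM)// addrC (maxn_idPr _).
Qed.

Let e_scale c A : 0 <= c -> \sum_(i <- A) c * e i <= c * E.
Proof. by move=> c0; rewrite -mulr_sumr ler_wpM2l. Qed.

Lemma summable_term n : cvg (partial_sum (a n) @ totally).
Proof.
apply: (@cvg_partial_sumC _ (b n * E)) => A.
by apply: le_trans (e_scale A (b0 n)) => //; exact: ler_sum.
Qed.

Lemma summable_limit : cvg (partial_sum s @ totally).
Proof.
apply: (@cvg_partial_sumC _ ((limn P - P 0%N) * E)) => A.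
apply: le_trans (e_scale A (P_sub_ge0 _)).
apply: ler_sum => i _; have := tail 0%N i.
by rewrite [X in s i - X]big_geq// subr0.
Qed.

(* The remainder after N terms is at most (sum of the e i) * (tail of the b n). *)
Lemma exchange_sums :
  (fun N => \sum_(1 <= n < N) lim (partial_sum (a n) @ totally)) @ \oo
    --> lim (partial_sum s @ totally).
Proof.
have E0 : 0 <= E by have := eE fset0; rewrite big_seq_fset0.
have bound N : normc (lim (partial_sum s @ totally) -
    \sum_(1 <= n < N) lim (partial_sum (a n) @ totally)) <= (limn P - P N) * E.
  have -> : lim (partial_sum s @ totally) -
      \sum_(1 <= n < N) lim (partial_sum (a n) @ totally) =
      lim (partial_sum (fun i => s i - \sum_(1 <= n < N) a n i) @ totally).
    apply/esym/cvgC_lim.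
    rewrite (_ : partial_sum _ = (fun A => partial_sum s A -
        \sum_(1 <= n < N) partial_sum (a n) A)).
      apply: cvgB; first exact: summable_limit.
      by apply: cvgC_sum => n; exact: summable_term.
    apply/funext => A; rewrite !partial_sumE sumrB; congr (_ - _).
    rewrite exchange_big; apply: eq_bigr => n _; by rewrite partial_sumE.
  apply: normc_lim_partial_sum => A.
  apply: le_trans (e_scale A (P_sub_ge0 _)).
  by apply: ler_sum => i _; exact: tail.
apply/cvgC_normcP => d d0.
have : (limn P - P N) * E @[N --> \oo] --> (limn P - limn P) * E.
  by apply: cvgM; [apply: cvgB; [exact: cvg_cst|exact: cP]|exact: cvg_cst].
rewrite subrr mul0r => /cvgrPdist_lt/(_ d d0).
apply: filterS => N; rewrite sub0r normrN ger0_norm ?mulr_ge0 ?subr_ge0//.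
exact: le_lt_trans.
Qed.

End exchange.
End unordered_sums.

(** * The Gamma function at half-integers *)

Section half_integer_gamma.
Variable R : realType.
Local Notation mu := (@lebesgue_measure R).
Local Notation H := (@gauss_integral_proof.integral0_gauss R).

Lemma derive_integral0_gauss (x : R) : 0 < x -> is_derive x 1 H (gauss_fun x).
Proof.
move=> x0; have xx1 : x < x + 1 by rewrite ltrDl.
have gi : mu.-integrable `[0, x + 1] (EFin \o @gauss_fun R).
  apply: continuous_compact_integrable; first exact: segment_compact.
  by apply: continuous_subspaceT; exact: continuous_gauss_fun.
have [||dH H'] := @continuous_FTC1_closed R (@gauss_fun R) 0 x (x + 1) xx1 gi.
- exact: x0.
- exact: continuous_gauss_fun.
- by apply: DeriveDef; [exact: dH|rewrite -derive1E].
Qed.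

Lemma integral0_gauss0 : H 0 = 0.
Proof.
by rewrite /gauss_integral_proof.integral0_gauss set_itv1 Rintegral_set1.
Qed.

Lemma integral0_gauss_cvg0 : H x @[x --> 0^'+] --> (0 : R).
Proof.
have : {within `[0, 1], continuous (fun x => parameterized_integral mu 0 x (@gauss_fun R))}.
  apply: parameterized_integral_continuous => //.
  apply: continuous_compact_integrable; first exact: segment_compact.
  by apply: continuous_subspaceT; exact: continuous_gauss_fun.
move/(continuous_within_itvP _ ltr01) => [_ + _].
by rewrite [X in _ --> X]/parameterized_integral set_itv1 Rintegral_set1.
Qed.

(** The square of [H] tends to pi / 4, and [H] is nonnegative, so the square root may be taken. *)
Lemma integral0_gauss_cvgy : H x @[x --> +oo] --> (Num.sqrt pi / 2 : R).
Proof.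
have : Num.sqrt (H x ^+ 2) @[x --> +oo] --> (Num.sqrt (pi / 4) : R).
  apply: continuous_cvg; first exact: sqrt_continuous.
  exact: gauss_integral_proof.cvg_integral0_gauss_sqr.
have -> : Num.sqrt (pi / 4) = Num.sqrt pi / 2 :> R.
  rewrite sqrtrM ?pi_ge0// sqrtrV//; congr (_ / _).
  by rewrite (_ : 4 = 2 ^+ 2) ?sqrtr_sqr ?ger0_norm// -natrX.
rewrite (_ : (fun _ => Num.sqrt _) = H)//.
apply/funext => r; rewrite sqrtr_sqr// ger0_norm//.
exact: gauss_integral_proof.integral0_gauss_ge0.
Qed.

(** The integrand of Gamma(m + 3/2). Writing the half power with [Num.sqrt] makes it continuous on
    the whole line, in particular at the endpoint 0. *)
Definition gamma_integrand m (t : R) := Num.sqrt t * t ^+ m * expR (- t).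

Lemma gamma_integrand_ge0 m t : 0 <= t -> 0 <= gamma_integrand m t.
Proof. by move=> t0; rewrite !mulr_ge0 ?sqrtr_ge0 ?exprn_ge0 ?expR_ge0. Qed.

Lemma continuous_gamma_integrand m : continuous (gamma_integrand m).
Proof.
move=> t; apply: cvgM; first apply: cvgM.
- exact: sqrt_continuous.
- exact: exprn_continuous.
- by apply: continuous_comp; [exact: oppr_continuous|exact: continuous_expR].
Qed.

(** For t >= 1 the integrand is at most t^(m+1) exp(-t), and exp t exceeds the term of degree m + 2
    of its own series. *)
Lemma gamma_integrand_cvgy m : gamma_integrand m t @[t --> +oo] --> (0 : R).
Proof.
apply/cvgrPdist_lt => e e0; near=> t.
have t1 : 1 <= t by near: t; exact: nbhs_pinfty_ge.
have t0 : 0 < t by exact: lt_le_trans t1.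
rewrite sub0r normrN ger0_norm ?gamma_integrand_ge0 ?(ltW t0)//.
rewrite /gamma_integrand expRN ltr_pdivrMr ?expR_gt0//.
have st : Num.sqrt t <= t.
  rewrite -[leRHS]ger0_norm ?(ltW t0)// -sqrtr_sqr ler_sqrt ?sqr_ge0//.
  by rewrite expr2 ler_peMr// ltW.
apply: (@le_lt_trans _ _ (t * t ^+ m)); first by rewrite ler_wpM2r ?exprn_ge0 ?(ltW t0).
have := @expR_ge1Dxn R t m.+1 (ltW t0).
rewrite -ltr_pdivrMl//; apply: lt_le_trans.
rewrite ltr_pwDl// ler_pdivlMr ?ltr0n ?fact_gt0//.
by rewrite -exprS mulrAC (exprS t m.+1) ler_wpM2r ?exprn_ge0 ?(ltW t0).
Unshelve. all: by end_near. Qed.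

(* An antiderivative of t^(m - 1/2) exp(-t), from integration by parts. *)
Fixpoint gamma_primitive m (t : R) : R :=
  if m is m'.+1
  then (m'%:R + 2^-1) * gamma_primitive m' t - gamma_integrand m' t
  else 2 * H (Num.sqrt t).

(** The value Gamma(m + 1/2), from the functional equation and Gamma(1/2) = sqrt pi. *)
Fixpoint gamma_half m : R :=
  if m is m'.+1 then (m'%:R + 2^-1) * gamma_half m' else Num.sqrt pi.

(** The case m = 0 is the substitution t = u^2, which turns t^(-1/2) exp(-t) dt into 2 exp(-u^2)
    du. *)
Lemma gamma_primitive_derive m (t : R) : 0 < t ->
  is_derive t 1 (gamma_primitive m) (t ^+ m * expR (- t) / Num.sqrt t).
Proof.
move=> t0; have st : 0 < Num.sqrt t by rewrite sqrtr_gt0.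
have st2 : Num.sqrt t * Num.sqrt t = t by rewrite -expr2 sqr_sqrtr// ltW.
elim: m => [|m IH] /=.
  have dH := derive_integral0_gauss st.
  have dHs := is_derive1_comp dH (is_derive1_sqrt t0).
  apply: is_derive_eq => /=.
  rewrite /gauss_fun sqr_sqrtr ?ltW// /GRing.scale/=; field; lra.
have ds := is_derive1_sqrt t0.
rewrite /gamma_integrand.
have de : is_derive t 1 (fun x : R => expR (- x)) (- expR (- t)).
  by apply: is_derive_eq; rewrite /GRing.scale/=; ring.
have dX : is_derive t 1 (fun x : R => x ^+ m) (m%:R * t ^+ m / t).
  apply: DeriveDef; first exact: exprn_derivable.
  rewrite exp_derive /GRing.scale/= mulr1.
  case: m {IH} => [|m]/=; first by rewrite !mul0r.
  by rewrite exprS [t * _]mulrC mulrA mulfK ?gt_eqF.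
apply: is_derive_eq; rewrite /GRing.scale/=.
rewrite exprS; move: (t ^+ m) (expR (- t)) (Num.sqrt t) st st2 => p E s s0 <-.
field; lra.
Qed.

Lemma gamma_primitive_cvg0 m : gamma_primitive m t @[t --> 0^'+] --> (0 : R).
Proof.
elim: m => [|m IH] /=.
  rewrite -[X in _ --> X](mulr0 2); apply: (cvgM (cvg_cst _)).
  have /cvgrPdist_lt Hcvg := integral0_gauss_cvg0.
  apply/cvgrPdist_lt => e e0; have [d /= d0 Hd] := Hcvg e e0.
  near=> t; have t0 : 0 < t by near: t; exact: nbhs_right_gt.
  apply: Hd => /=; last by rewrite sqrtr_gt0.
  rewrite sub0r normrN ger0_norm ?sqrtr_ge0// -[ltRHS]ger0_norm ?(ltW d0)//.
  rewrite -sqrtr_sqr ltr_sqrt ?exprn_gt0//.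
  by near: t; apply: nbhs_right_lt; rewrite exprn_gt0.
rewrite -[X in _ --> X]subr0; apply: cvgB.
  by rewrite -[X in _ --> X](mulr0 (m%:R + 2^-1)); apply: (cvgM (cvg_cst _)).
apply: cvg_at_right_filter.
have := @continuous_gamma_integrand m 0; rewrite /prop_for /continuous_at.
by rewrite [X in _ --> X]/gamma_integrand sqrtr0 !mul0r.
Unshelve. all: by end_near. Qed.

Lemma gamma_primitive0 m : gamma_primitive m 0 = 0.
Proof.
elim: m => [|m IH] /=; first by rewrite sqrtr0 integral0_gauss0 mulr0.
by rewrite IH /gamma_integrand sqrtr0 mulr0 !mul0r subrr.
Qed.

Lemma gamma_primitive_cvgy m : gamma_primitive m t @[t --> +oo] --> gamma_half m.
Proof.
elim: m => [|m IH] /=.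
  rewrite -[X in _ --> X](@divfK _ 2)// [_ / 2 * 2]mulrC; apply: (cvgM (cvg_cst _)).
  have : Num.sqrt t @[t --> +oo] --> (+oo : set_system R).
    apply/cvgryPge => A; near=> t.
    rewrite (le_trans (ler_norm A))// -sqrtr_sqr ler_wsqrtr//.
  by move/cvg_comp; apply; exact: integral0_gauss_cvgy.
rewrite -[X in _ --> X]subr0; apply: cvgB; first by apply: (cvgM (cvg_cst _)).
exact: gamma_integrand_cvgy.
Unshelve. all: by end_near. Qed.

Lemma gamma_integral m :
  \int[mu]_(t in `]0, +oo[) gamma_integrand m t = gamma_half m.+1.
Proof.
have mg : measurable_fun [set: R] (gamma_integrand m).
  by apply: measurable_realfun.continuous_measurable_fun; exact: continuous_gamma_integrand.
rewrite /Rintegral integral_itv_obnd_cbnd; last first.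
  by apply/measurable_realfun.measurable_EFinP; exact: measurable_funTS.
rewrite (@ge0_continuous_FTC2y R _ (gamma_primitive m.+1) 0 (gamma_half m.+1)).
- by rewrite gamma_primitive0 sube0.
- by move=> x; exact: gamma_integrand_ge0.
- by apply: continuous_subspaceT; exact: continuous_gamma_integrand.
- exact: gamma_primitive_cvgy.
- by move=> x x0; have [] := gamma_primitive_derive m.+1 x0.
- by rewrite gamma_primitive0; exact: gamma_primitive_cvg0.
- move=> x; rewrite in_itv/= andbT => x0.
  rewrite derive1E; have [_ ->] := gamma_primitive_derive m.+1 x0.
  have s0 : 0 < Num.sqrt x by rewrite sqrtr_gt0.
  rewrite /gamma_integrand exprS -[X in X * _ ^+ m](@sqr_sqrtr _ x) ?ltW//.
  move: (x ^+ m) (expR (- x)) => p E; field; lra.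
Qed.

End half_integer_gamma.

(** * The Bessel function of order 3/2 *)

Section bessel.
Variable R : realType.

Lemma realC_nat (n : nat) : (n%:R : R)%:C = n%:R :> R[i].
Proof. exact: rmorph_nat. Qed.

(** The right-hand side is the shape in which half-integer exponents arise from the order s - 1/2 at
    s = 2, in Euler's integral and in the Bessel series. *)
Lemma realC_nat_half (n : nat) :
  (n%:R + 2^-1 : R)%:C = 2 - 2^-1 + n%:R - 1 :> R[i].
Proof.
rewrite rmorphD/= realC_nat fmorphV/= (_ : 2%:C = 2) ?(rmorph_nat _ 2)//.
by field.
Qed.

Lemma cexp_real (x : R) : cexp x%:C = (expR x)%:C.
Proof. by rewrite /cexp /= cos0 sin0 mulr1. Qed.

Lemma cpowR_real (x r : R) : cpowR x r%:C = (expR (ln x * r))%:C.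
Proof. by rewrite /cpowR -rmorphM cexp_real. Qed.

Lemma expR_ln_half (x : R) (m : nat) : 0 < x ->
  expR (ln x * (m%:R + 2^-1)) = Num.sqrt x * x ^+ m.
Proof.
move=> x0; rewrite mulrDr expRD expRM_natr lnK ?posrE// mulrC; congr (_ * _).
apply: (@pexpIrn _ 2); rewrite ?nnegrE ?expR_ge0 ?sqrtr_ge0//.
rewrite sqr_sqrtr ?ltW// -expRM_natr -mulrA mulVf// mulr1 lnK ?posrE//.
Qed.

Lemma cGamma_half_integer (k : nat) :
  cGamma (2 - 2^-1 + k.+1%:R : R[i]) = (gamma_half R k.+2)%:C.
Proof.
have E (t : R) : 0 < t ->
    cpowR t (2 - 2^-1 + k.+1%:R - 1 : R[i]) * (expR (- t))%:C =
    (gamma_integrand k.+1 t)%:C.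
  move=> t0.
  by rewrite -realC_nat_half cpowR_real expR_ln_half// -rmorphM/=.
rewrite /cGamma; congr (_ +i* _).
  rewrite -gamma_integral; apply: eq_Rintegral => t.
  by rewrite inE/= in_itv/= andbT => /E/(congr1 (@complex.Re R)).
rewrite (@eq_Rintegral _ _ _ _ _ (cst 0)); last first.
  by move=> t; rewrite inE/= in_itv/= andbT => /E/(congr1 (@complex.Im R)).
by rewrite Rintegral_cst// mul0r.
Qed.

(** Legendre's duplication formula for Gamma(k + 2) Gamma(k + 5/2), divided by k + 1. It turns the
    Bessel coefficients into those of hyperbolic functions. *)
Lemma fact_gamma_half (k : nat) :
  k`!%:R * gamma_half R k.+2 =
  Num.sqrt pi * (2 * k + 3)`!%:R / (2 ^+ (2 * k + 3) * k.+1%:R).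
Proof.
elim: k => [|k IH].
  by rewrite /= !factS fact0 !muln1; field.
have -> : (2 * k.+1 + 3 = (2 * k + 3).+2)%N by lia.
rewrite !factS !natrM !exprS (_ : gamma_half R k.+3 =
  (k.+2%:R + 2^-1) * gamma_half R k.+2)//.
rewrite mulrACA IH.
have -> : (2 * k + 3).+2%:R = 2 * k%:R + 5 :> R by rewrite -[in RHS]natrM -natrD; congr (_%:R); lia.
have -> : (2 * k + 3).+1%:R = 2 * k%:R + 4 :> R by rewrite -[in RHS]natrM -natrD; congr (_%:R); lia.
have -> : k.+2%:R = k%:R + 2 :> R by rewrite -natrD addn2.
have -> : k.+1%:R = k%:R + 1 :> R by rewrite -natr1.
have k0 : 0 <= k%:R :> R by [].
field; rewrite !expf_neq0//=; apply/andP; split; lra.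
Qed.

(** This is 2 (cosh t - sinh t / t), normalized so that I_{3/2}(t) is its quotient by sqrt(2 pi
    t). *)
Definition cosh_defect (t : R) : R :=
  expR t + expR (- t) - (expR t - expR (- t)) / t.

Let coeff (t : R) (k : nat) : R := 4 * k.+1%:R * t ^+ (2 * k + 2) / (2 * k + 3)`!%:R.

(** The constant terms cancel, and t^(2k+2) has the coefficient 2 / (2k+2)! - 2 / (2k+3)! = 4 (k+1)
    / (2k+3)!. *)
Lemma series_cosh_defect (t : R) : t != 0 ->
  series (coeff t) @ \oo --> cosh_defect t.
Proof.
move=> t0; pose S x n : R := series (exp_coeff x) n.
(* Cutting both exponentials after degree 2K + 1 leaves cosh t and sinh t / t both cut after degree
   2K, so the identity of partial sums is exact. *)
have E K : series (coeff t) K = S t (2 * K + 2)%N + S (- t) (2 * K + 2)%N -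
    (S t (2 * K + 2)%N - S (- t) (2 * K + 2)%N) / t.
  elim: K => [|K IH].
    rewrite /series/= big_geq// /S /series /= !big_nat_recr//= !big_geq//.
    rewrite /exp_coeff/= !expr0 !expr1 !fact0 (factS 0) fact0 !divr1; field; exact: t0.
  have -> : series (coeff t) K.+1 = series (coeff t) K + coeff t K.
    by rewrite /series/= big_nat_recr.
  rewrite IH.
  have -> : (2 * K.+1 + 2 = (2 * K + 2).+2)%N by lia.
  have SS x n : S x n.+1 = S x n + x ^+ n / n`!%:R.
    by rewrite /S /series/= big_nat_recr.
  rewrite !SS /coeff (_ : (2 * K + 3 = (2 * K + 2).+1)%N); last by lia.
  rewrite factS natrM.
  have ev : (- t) ^+ (2 * K + 2) = t ^+ (2 * K + 2).
    by rewrite -mulnSr exprM sqrrN -exprM.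
  have f0 : (2 * K + 2)`!%:R != 0 :> R by rewrite pnatr_eq0 -lt0n fact_gt0.
  rewrite ![_ ^+ (2 * K + 2).+1]exprS ev.
  have -> : (2 * K + 2).+1%:R = 2 * K%:R + 3 :> R by rewrite -[in RHS]natrM -natrD; congr (_%:R); lia.
  have -> : K.+1%:R = K%:R + 1 :> R by rewrite -natr1.
  have k0 : 0 <= K%:R :> R by [].
  field; rewrite f0 t0 /=; lra.
have sub : (fun K => (2 * K + 2)%N) @ \oo --> \oo.
  by move=> A [N _ NA]; exists N => // n /= Nn; apply: NA => /=; lia.
have Sc x : S x (2 * K + 2)%N @[K --> \oo] --> expR x.
  by apply: (cvg_comp _ _ sub); exact: is_cvg_series_exp_coeff.
rewrite (_ : series _ = (fun K => S t (2 * K + 2)%N + S (- t) (2 * K + 2)%N -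
    (S t (2 * K + 2)%N - S (- t) (2 * K + 2)%N) / t)); last exact/funext.
by apply: cvgB; [exact: cvgD|apply: cvgM; [exact: cvgB|exact: cvg_cst]].
Qed.

Lemma cosh_defect_ge0 (t : R) : 0 < t -> 0 <= cosh_defect t.
Proof.
move=> t0; have /cvg_lim <- // := @series_cosh_defect t (lt0r_neq0 t0).
apply: limr_ge.
  by apply/cvg_ex; exists (cosh_defect t); exact/series_cosh_defect/lt0r_neq0.
apply: nearW => n; apply: sumr_ge0 => k _.
by rewrite /coeff !mulr_ge0 ?invr_ge0 ?exprn_ge0 ?(ltW t0).
Qed.

(** Invert exp u >= 1 + u + u^2/2, using (1 + u + u^2/2) (1 - u + u^2/2) = 1 + u^4/4 >= 1. *)
Lemma expRN_le (u : R) : 0 <= u -> expR (- u) <= 1 - u + u ^+ 2 / 2.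
Proof.
move=> u0; rewrite expRN.
have h : 1 + u + u ^+ 2 / 2 <= expR u.
  have -> : 1 + u + u ^+ 2 / 2 = series (exp_coeff u) 3.
    rewrite /series/= !big_nat_recr//= big_geq// /exp_coeff/= expr0 expr1.
    by rewrite !factS fact0 add0r !divr1.
  apply: nondecreasing_cvgn_le; last exact: is_cvg_series_exp_coeff.
  by apply/nondecreasing_series => n _ _; exact: exp_coeff_ge0.
have p : 0 < 1 - u + u ^+ 2 / 2 by nra.
rewrite invf_ple ?posrE ?expR_gt0// (le_trans _ h)//.
suff : 1 <= (1 + u + u ^+ 2 / 2) * (1 - u + u ^+ 2 / 2).
  by rewrite -ler_pdivrMr// mul1r.
have -> : (1 + u + u ^+ 2 / 2) * (1 - u + u ^+ 2 / 2) = 1 + u ^+ 4 / 4 by field.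
by rewrite lerDl divr_ge0 ?exprn_ge0.
Qed.

(** After exp t is factored out, [expRN_le] at u = 2t bounds the cofactor by (2 - 2t + 2t^2) - (2 -
    2t). The quadratic decay at 0 is what produces squares of heights, the exponent for which sums
    over the orbit are controlled. *)
Lemma cosh_defect_le (t : R) : 0 < t -> cosh_defect t <= 2 * t ^+ 2 * expR t.
Proof.
move=> t0; have h := @expRN_le (2 * t) (mulr_ge0 (ler0n _ 2) (ltW t0)).
have -> : cosh_defect t =
    expR t * (1 + expR (- (2 * t)) - (1 - expR (- (2 * t))) / t).
  rewrite /cosh_defect (_ : - t = t - 2 * t); last by ring.
  by rewrite expRB expRN; field; rewrite lt0r_neq0// gt_eqF ?expR_gt0.
rewrite [leRHS]mulrC ler_wpM2l ?expR_ge0//.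
have : 2 - 2 * t <= (1 - expR (- (2 * t))) / t by rewrite ler_pdivlMr//; nra.
nra.
Qed.

Lemma besselI_three_half (t : R) : 0 < t ->
  besselI (2 - 2^-1) t = (cosh_defect t / Num.sqrt (2 * pi * t))%:C.
Proof.
move=> t0; rewrite /besselI; apply: cvgC_lim.
have t20 : 0 < t / 2 by rewrite divr_gt0.
have E k : cpowR (t / 2) (2 - 2^-1 + (2 * k)%N%:R) /
    (k`!%:R * cGamma (2 - 2^-1 + k.+1%:R)) =
    (coeff t k / Num.sqrt (2 * pi * t))%:C :> R[i].
  have -> : (2 - 2^-1 + (2 * k)%N%:R : R[i]) = ((2 * k + 1)%N%:R + 2^-1 : R)%:C.
    by rewrite realC_nat_half natrD addrA addrK.
  rewrite cpowR_real expR_ln_half// cGamma_half_integer -realC_nat.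
  rewrite -rmorphM/= fact_gamma_half -fmorphV -rmorphM/=; congr (_%:C).
  have f0 : (2 * k + 3)`!%:R != 0 :> R by rewrite pnatr_eq0 -lt0n fact_gt0.
  have sp : 0 < Num.sqrt pi :> R by rewrite sqrtr_gt0 pi_gt0.
  have st : 0 < Num.sqrt (2 * t) :> R by rewrite sqrtr_gt0 mulr_gt0.
  have -> : Num.sqrt (2 * pi * t) = Num.sqrt pi * Num.sqrt (2 * t).
    by rewrite -sqrtrM ?pi_ge0//; congr Num.sqrt; ring.
  have -> : Num.sqrt (t / 2) = t / Num.sqrt (2 * t).
    apply: (@mulIf _ (Num.sqrt (2 * t))); first by rewrite lt0r_neq0.
    rewrite divfK ?lt0r_neq0// -sqrtrM ?(ltW t20)//.
    have -> : t / 2 * (2 * t) = t ^+ 2 by field.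
    by rewrite sqrtr_sqr gtr0_norm.
  rewrite /coeff (_ : (2 * k + 2 = (2 * k + 1).+1)%N) ?addnS//.
  rewrite (_ : (2 * k + 3 = (2 * k + 1).+2)%N) ?addnS// in f0 *.
  rewrite expr_div_n !exprS.
  have p0 : (2 : R) ^+ (2 * k + 0) != 0 by rewrite expf_neq0.
  have k0 : k.+1%:R != 0 :> R by rewrite pnatr_eq0.
  move: (k.+1%:R : R) k0 => c c0.
  by field; rewrite f0 p0 c0 !lt0r_neq0.
rewrite (_ : series _ = fun n => (series (coeff t) n / Num.sqrt (2 * pi * t))%:C).
  apply: cvgC_real; apply: cvgM; last exact: cvg_cst.
  exact/series_cosh_defect/lt0r_neq0.
apply/funext => n; rewrite /series/= mulr_suml rmorph_sum/=.
by apply: eq_bigr => k _; rewrite E.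
Qed.

End bessel.

(** * The series of the principal logarithm *)

Section logarithm_series.
Variable R : realType.

Lemma ReD (x y : R[i]) : complex.Re (x + y) = complex.Re x + complex.Re y.
Proof. by case: x y => [? ?] [? ?]. Qed.

Lemma ImD (x y : R[i]) : complex.Im (x + y) = complex.Im x + complex.Im y.
Proof. by case: x y => [? ?] [? ?]. Qed.

(** Here x / |w| = cos(atan(y / x)), and the sign convention of [carg] agrees with that of atan.
    Both components become differentiable real functions. *)
Lemma cLog_Re_gt0 (w : R[i]) : 0 < complex.Re w ->
  cLog w = ln (normc w) +i* atan (complex.Im w / complex.Re w).
Proof.
case: w => x y /= x0; rewrite /cLog/=; congr (_ +i* _).
have D0 : 0 < x ^+ 2 + y ^+ 2 by rewrite ltr_wpDr ?sqr_ge0 ?exprn_gt0.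
have cE : x / Num.sqrt (x ^+ 2 + y ^+ 2) = cos (atan (y / x)).
  rewrite cos_atan (_ : 1 + (y / x) ^+ 2 = (x ^+ 2 + y ^+ 2) / x ^+ 2); last first.
    by field; rewrite gt_eqF.
  by rewrite sqrtrM ?ltW// sqrtrV ?sqr_ge0// sqrtr_sqr gtr0_norm// invf_div.
have p2 : pi / 2 <= pi :> R by have := @pi_gt0 R; lra.
rewrite /carg/= cE; case: ifPn => [y0|]; last rewrite -ltNge => y0.
  rewrite cosK// in_itv/= -{1}atan0 le_atan ?divr_ge0 ?(ltW x0)//=.
  exact: le_trans (ltW (atan_ltpi2 _)) p2.
have yx0 : y / x <= 0 by rewrite pmulr_lle0 ?invr_gt0// ltW.
rewrite cosKN ?opprK//; apply/andP; split; last by rewrite -[leRHS]atan0 le_atan.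
by apply: le_trans (ltW (atan_gtNpi2 _)); rewrite lerN2.
Qed.

Lemma variation_le (f df : R -> R) (M : R) :
  (forall s : R, 0 <= s <= 1 -> is_derive s 1 f (df s)) ->
  (forall s : R, 0 <= s <= 1 -> `|df s| <= M) -> `|f 1 - f 0| <= M.
Proof.
move=> fdf dfM; have [c||c] := @MVT R f df 0 1 ltr01.
- by rewrite in_itv/= => /andP[/ltW c0 /ltW c1]; apply: fdf; rewrite c0.
- apply: derivable_within_continuous => c; rewrite in_itv/= => c01.
  by have [] := fdf c c01.
- rewrite in_itv/= subr0 mulr1 => /andP[/ltW c0 /ltW c1] ->.
  by apply: dfM; rewrite c0.
Qed.

Lemma sum_geometric (F : fieldType) (x : F) N : x != 1 ->
  \sum_(0 <= k < N) x ^+ k = (1 - x ^+ N) / (1 - x).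
Proof.
move=> x1; have x1' : 1 - x != 0 by rewrite subr_eq0 eq_sym.
apply: (mulIf x1'); rewrite divfK// big_mkord.
by rewrite -opprB mulrN mulrC -subrX1 opprB.
Qed.

Lemma cvg_geometric0 (r : R) : 0 <= r < 1 -> r ^+ N @[N --> \oo] --> (0 : R).
Proof. by move=> /andP[r0 r1]; apply: cvg_expr; rewrite ger0_norm. Qed.

(** * Geometric and logarithmic series at a point q of the open unit disc *)

Section fixed_point.
Variable q : R[i].
Hypothesis q1 : normc q < 1.
Local Notation a := (complex.Re q).
Local Notation b := (complex.Im q).
Local Notation r := (normc q).

Let r0 : 0 <= r. Proof. exact: normc_ge0. Qed.

Let a1 : `|a| < 1. Proof. exact: le_lt_trans (normc_ge_Re q) q1. Qed.

Let sa_lt1 (s : R) : 0 <= s <= 1 -> 0 < 1 - s * a.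
Proof.
move=> /andP[s0 s1]; rewrite subr_gt0; apply: (@le_lt_trans _ _ `|a|); last exact: a1.
apply: (le_trans (ler_norm _)); rewrite normrM ger0_norm// ler_piMl//.
Qed.

Let den_gt0 (s : R) : 0 <= s <= 1 -> 0 < (1 - s * a) ^+ 2 + (s * b) ^+ 2.
Proof. by move=> s01; rewrite ltr_wpDr ?sqr_ge0// exprn_gt0// sa_lt1. Qed.

Let normc_1B (s : R) : 0 <= s <= 1 -> 1 - r <= normc (1 - s%:C * q).
Proof.
move=> /andP[s0 s1]; have : normc (1 : R[i]) <= normc (1 - s%:C * q) + normc (s%:C * q).
  by rewrite -{1}[1 in X in X <= _](subrK (s%:C * q)) normcD_le.
rewrite normc1 normcM normc_real ger0_norm//.
have := r0; nra.
Qed.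

Let oneB_neq0 (s : R) : 0 <= s <= 1 -> 1 - s%:C * q != 0.
Proof.
move=> s01; apply/eqP => h; have := normc_1B s01.
by rewrite h normc0; have := q1; lra.
Qed.

Let quotE (s : R) : 0 <= s <= 1 -> q / (1 - s%:C * q) =
  ((a * (1 - s * a) - s * b ^+ 2) / ((1 - s * a) ^+ 2 + (s * b) ^+ 2))
  +i* (b / ((1 - s * a) ^+ 2 + (s * b) ^+ 2)).
Proof.
move=> s01; apply: (mulIf (oneB_neq0 s01)); rewrite divfK ?oneB_neq0//.
have := den_gt0 s01; case: (q) => x y /= D0.
by simpc; congr (_ +i* _); field; rewrite gt_eqF.
Qed.

Lemma normc_geometric_tail (s : R) N : 0 <= s <= 1 ->
  normc (q / (1 - s%:C * q) * (s%:C * q) ^+ N) <= r ^+ N.+1 / (1 - r).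
Proof.
move=> s01; have /andP[s0 s1] := s01.
rewrite !normcM normcX normcV normcM normc_real ger0_norm// exprS -!mulrA.
rewrite ler_wpM2l// mulrC ler_pM ?exprn_ge0 ?mulr_ge0 ?invr_ge0 ?normc_ge0//.
  by rewrite lerXn2r ?nnegrE ?mulr_ge0// ler_piMl.
by rewrite lef_pV2 ?posrE ?normc_1B// ?subr_gt0// (lt_le_trans _ (normc_1B s01))// subr_gt0.
Qed.

Let polyRI (c : nat -> R) N (s : R) :
  is_derive s 1 (fun s : R => \sum_(0 <= k < N) s ^+ k.+1 / k.+1%:R * c k.+1)
    (\sum_(0 <= k < N) s ^+ k * c k.+1).
Proof.
elim: N => [|N IH].
  rewrite big_geq//; under eq_fun do rewrite big_geq//; exact: is_derive_cst.
rewrite big_nat_recr//=; under eq_fun do rewrite big_nat_recr//=.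
apply: is_deriveD.
have dX : is_derive s 1 (fun x : R => x ^+ N.+1) (N.+1%:R * s ^+ N).
  apply: DeriveDef; first exact: exprn_derivable.
  by rewrite exp_derive /GRing.scale/= mulr1.
rewrite (_ : (fun x => _) = (fun x : R => (c N.+1 / N.+1%:R) * x ^+ N.+1)).
  apply: is_derive_eq; rewrite /GRing.scale/=.
  have : N.+1%:R != 0 :> R by rewrite pnatr_eq0.
  by move: (N.+1%:R : R) => n n0; field.
by apply/funext => x; rewrite mulrAC [LHS]mulrC mulrA mulrAC [_ * c _]mulrC.
Qed.

Let geomC N (s : R) : 0 <= s <= 1 ->
  \sum_(0 <= k < N) (s ^+ k)%:C * q ^+ k.+1 =
  q / (1 - s%:C * q) - q / (1 - s%:C * q) * (s%:C * q) ^+ N.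
Proof.
move=> s01; rewrite -[X in X - _]mulr1 -mulrBr mulrAC -mulrA -sum_geometric; last first.
  by rewrite eq_sym -subr_eq0 oneB_neq0.
by rewrite mulr_sumr; apply: eq_bigr => k _; rewrite exprS exprMn rmorphXn/= mulrCA.
Qed.

Let Re_sum N s : \sum_(0 <= k < N) s ^+ k * complex.Re (q ^+ k.+1) =
  complex.Re (\sum_(0 <= k < N) (s ^+ k)%:C * q ^+ k.+1).
Proof.
rewrite (raddf_sum (@complex.Re R)); apply: eq_bigr => k _.
by case: (q ^+ k.+1) => x y; simpc.
Qed.

Let Im_sum N s : \sum_(0 <= k < N) s ^+ k * complex.Im (q ^+ k.+1) =
  complex.Im (\sum_(0 <= k < N) (s ^+ k)%:C * q ^+ k.+1).
Proof.
rewrite (raddf_sum (@complex.Im R)); apply: eq_bigr => k _.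
by case: (q ^+ k.+1) => x y; simpc.
Qed.

(** The function is the real part of Log(1 - s q) plus the first N terms of the series for s q.
    Differentiation turns these terms into a truncated geometric series, which leaves minus the
    geometric tail; [dIm] does the same for the imaginary part. *)
Let dRe N (s : R) : 0 <= s <= 1 -> is_derive s 1
  (fun s : R => 2^-1 * ln ((1 - s * a) ^+ 2 + (s * b) ^+ 2) +
     \sum_(0 <= k < N) s ^+ k.+1 / k.+1%:R * complex.Re (q ^+ k.+1))
  (- complex.Re (q / (1 - s%:C * q) * (s%:C * q) ^+ N)).
Proof.
move=> s01; have dp := polyRI (fun n => complex.Re (q ^+ n)) N s.
have D0 := den_gt0 s01.
have dD : is_derive s 1 (fun s : R => (1 - s * a) ^+ 2 + (s * b) ^+ 2)
    (- 2 * a * (1 - s * a) + 2 * s * b ^+ 2).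
  by apply: is_derive_eq; rewrite /GRing.scale/=; ring.
have dL := @is_derive1_comp _ (@ln R) (fun s : R => (1 - s * a) ^+ 2 + (s * b) ^+ 2) _ _ _ (is_derive1_ln D0) dD.
apply: is_derive_eq; rewrite Re_sum geomC// raddfB/= addrA.
apply/eqP; rewrite subr_eq addNr addr_eq0; apply/eqP.
by rewrite quotE//= /GRing.scale/=; field; rewrite gt_eqF.
Qed.

Let dIm N (s : R) : 0 <= s <= 1 -> is_derive s 1
  (fun s : R => atan (- (s * b) / (1 - s * a)) +
     \sum_(0 <= k < N) s ^+ k.+1 / k.+1%:R * complex.Im (q ^+ k.+1))
  (- complex.Im (q / (1 - s%:C * q) * (s%:C * q) ^+ N)).
Proof.
move=> s01; have dp := polyRI (fun n => complex.Im (q ^+ n)) N s.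
have D0 := den_gt0 s01; have E0 := sa_lt1 s01.
have En0 : 1 - s * a != 0 by rewrite gt_eqF.
have d1 : is_derive s 1 (fun s : R => 1 - s * a) (- a).
  by apply: is_derive_eq; rewrite /GRing.scale/=; ring.
have d2 := @is_deriveV _ (fun s : R => 1 - s * a) _ _ _ En0 d1.
have dD : is_derive s 1 (fun s : R => - (s * b) / (1 - s * a))
    (- b / (1 - s * a) ^+ 2).
  apply: is_derive_eq; rewrite /GRing.scale/=; field; exact: En0.
have dL := @is_derive1_comp _ (@atan R) (fun s : R => - (s * b) / (1 - s * a)) _ _ _ (is_derive1_atan _) dD.
apply: is_derive_eq; rewrite Im_sum geomC// raddfB/= addrA.
apply/eqP; rewrite subr_eq addNr addr_eq0; apply/eqP.
rewrite quotE//= /GRing.scale/=; field.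
by rewrite En0 !gt_eqF// sqrrN.
Qed.

(** Both components vanish at s = 0, so the mean value theorem on [0, 1] bounds each by the supremum
    of the geometric tail. It applies to the two components separately, hence two equal summands. *)
Lemma log_series_bound N :
  normc (cLog (1 - q) + \sum_(1 <= n < N.+1) q ^+ n / n%:R) <=
  r ^+ N.+1 / (1 - r) + r ^+ N.+1 / (1 - r).
Proof.
have u01 : 0 <= (1 : R) <= 1 by rewrite ler01 lexx.
have Sre (x : R[i]) n : complex.Re (x / n%:R) = complex.Re x / n%:R /\
    complex.Im (x / n%:R) = complex.Im x / n%:R.
  have -> : (n%:R)^-1 = (n%:R^-1 : R)%:C :> R[i] by rewrite fmorphV/= realC_nat.
  by case: x => x y; split; rewrite /= mulr0 ?subr0 ?add0r.
have logRe : 0 < complex.Re (1 - q) by have := sa_lt1 u01; case: (q) => x y /=; rewrite mul1r.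
apply: (le_trans (normc_le_ReIm _)); rewrite big_add1/= cLog_Re_gt0//.
apply: lerD.
- have := variation_le (dRe N) (fun s s01 => le_trans (eq_ind_r (fun x => x <= _)
    (normc_ge_Re _) (normrN _)) (normc_geometric_tail N s01)).
  congr (`|_| <= _).
  rewrite ReD (raddf_sum (@complex.Re R)) !mul0r subr0 expr0n/= addr0.
  rewrite expr1n ln1 mulr0 add0r [X in _ - X]big1 ?subr0; last first.
    by move=> k _; rewrite expr0n !mul0r.
  congr (_ + _); last by apply: eq_bigr => k _; rewrite expr1n mul1r (Sre _ _).1 mulrC.
  have -> : normc (1 - q) = Num.sqrt ((1 - a) ^+ 2 + b ^+ 2).
    by case: (q) => x y; rewrite /normc/=; congr Num.sqrt; ring.
  have := den_gt0 u01; rewrite !mul1r => D0.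
  by rewrite -{1}(sqr_sqrtr (ltW D0)) lnXn ?sqrtr_gt0//; field.
- have := variation_le (dIm N) (fun s s01 => le_trans (eq_ind_r (fun x => x <= _)
    (normc_ge_Im _) (normrN _)) (normc_geometric_tail N s01)).
  congr (`|_| <= _).
  rewrite ImD (raddf_sum (@complex.Im R)) !mul0r oppr0 mul0r atan0 add0r.
  rewrite [X in _ - X]big1 ?subr0; last first.
    by move=> k _; rewrite expr0n !mul0r.
  congr (_ + _); last by apply: eq_bigr => k _; rewrite expr1n mul1r mulrC; exact/esym/(Sre _ _).2.
  by case: (q) => x y /=; rewrite !mul1r sub0r.
Qed.

Lemma cvg_log_series :
  (fun N => \sum_(1 <= n < N) q ^+ n / n%:R) @ \oo --> - cLog (1 - q).
Proof.
apply/cvgC_normcP => e e0.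
have : r ^+ N / (1 - r) + r ^+ N / (1 - r) @[N --> \oo] --> 0 / (1 - r) + 0 / (1 - r).
  by apply: cvgD; apply: cvgM; (exact: cvg_cst || (apply: cvg_geometric0; rewrite r0)).
rewrite mul0r addr0 => /cvgrPdist_lt/(_ e e0) [M _ HM].
exists M.+1 => // -[|N] //= MN.
rewrite -normcN opprB opprK addrC (le_lt_trans (log_series_bound N))//.
have := HM N.+1 (leqW MN); rewrite sub0r normrN; apply: le_lt_trans.
exact: ler_norm.
Qed.

Lemma cvg_geometric_series1 :
  (fun N => \sum_(1 <= n < N) q ^+ n) @ \oo --> q / (1 - q).
Proof.
have u01 : 0 <= (1 : R) <= 1 by rewrite ler01 lexx.
apply/cvgC_normcP => e e0.
have : r ^+ N / (1 - r) @[N --> \oo] --> 0 / (1 - r).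
  by apply: cvgM; [apply: cvg_geometric0; rewrite r0|exact: cvg_cst].
rewrite mul0r => /cvgrPdist_lt/(_ e e0) [M _ HM].
exists M.+1 => // -[|N] //= MN.
have := HM N.+1 (leqW MN); rewrite sub0r normrN; apply: le_lt_trans.
apply: le_trans (ler_norm _); apply: le_trans (normc_geometric_tail N u01).
have := geomC N u01; rewrite (eq_bigr (fun k => q ^+ k.+1)); last first.
  by move=> k _; rewrite expr1n mul1r.
by rewrite mul1r big_add1/= => ->; rewrite opprB addrC subrK.
Qed.

End fixed_point.
End logarithm_series.

(** * A packing argument and Shimizu's lemma *)

Section packing.
Variable R : realType.
Local Notation mu := (@lebesgue_measure R).

(* The rectangles ]u_i - h_i/4, u_i + h_i/4[ x ]h_i/2, h_i[ are disjoint: if the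
   second sides of two of them meet then h_i and h_j differ by a factor less
   than 2, so that (h_i + h_j)/4 is at most the square root of h_i h_j. *)
Lemma sum_sqr_separated (I : choiceType) (A : {fset I}) (u h : I -> R) (H : R) :
  (forall i, i \in A -> `|u i| <= 1) ->
  (forall i, i \in A -> 0 < h i <= H) ->
  (forall i j, i \in A -> j \in A -> i != j -> h i * h j <= (u i - u j) ^+ 2) ->
  0 <= H ->
  \sum_(i <- A) h i ^+ 2 <= 4 * ((2 + H / 2) * H).
Proof.
move=> u1 hH sep H0.
pose T := (measurableTypeR R * measurableTypeR R)%type.
pose m2 : {measure set T -> \bar R} := (mu \x mu)%E.
pose F i : set T := `](u i - h i / 4), (u i + h i / 4)[ `*` `](h i / 2), (h i)[.
have mF i : measurable (F i) by apply: measurableX; exact: measurable_itv.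
have tF : trivIset [set` A] F.
  move=> i j /= iA jA [[x y]] [[/= hx hy] [/= hx' hy']].
  move: hx hy hx' hy'; rewrite !in_itv/=.
  move=> /andP[x1 x2] /andP[y1 y2] /andP[x3 x4] /andP[y3 y4].
  apply/eqP/negPn/negP => ij; have := sep i j iA jA ij.
  have /andP[hi0 _] := hH i iA; have /andP[hj0 _] := hH j jA.
  have d1 : u i - u j < (h i + h j) / 4 by lra.
  have d2 : - ((h i + h j) / 4) < u i - u j by lra.
  apply/negP; rewrite -ltNge.
  have d3 : (u i - u j) ^+ 2 < ((h i + h j) / 4) ^+ 2 by nra.
  apply: (lt_le_trans d3).
  have h1 : h i <= 2 * h j by lra.
  have h2 : h j <= 2 * h i by lra.
  nra.
(* Each rectangle has area h_i^2 / 4 and lies in this box of area (2 + H/2) H, since |u_i| <= 1 and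
   h_i <= H. *)
pose B : set T := `[(- (1 + H / 4)), (1 + H / 4)] `*` `[0, H].
have m2E (X Y : set R) : measurable X -> measurable Y ->
    m2 (X `*` Y) = (mu X * mu Y)%E.
  by move=> mX mY; exact: product_measure1E.
have mB : measurable B by apply: measurableX; exact: measurable_itv.
have m2B : m2 B = ((2 + H / 2) * H)%:E.
  rewrite m2E; [|exact: measurable_itv|exact: measurable_itv].
  rewrite !lebesgue_measure_itv/= !lte_fin -!EFinB.
  have -> : - (1 + H / 4) < 1 + H / 4 by lra.
  case: ifPn => [_|]; first by rewrite -EFinM; congr (_%:E); field.
  rewrite -leNgt => H0'; have H00 : H = 0 by lra.
  by rewrite mule0 H00 mulr0.
have E i : i \in A -> m2 (F i) = (h i ^+ 2 / 4)%:E.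
  move=> iA; have /andP[hi0 _] := hH i iA.
  rewrite m2E; [|exact: measurable_itv|exact: measurable_itv].
  rewrite !lebesgue_measure_itv/= !lte_fin -!EFinB.
  have -> : u i - h i / 4 < u i + h i / 4 by lra.
  have -> : h i / 2 < h i by lra.
  by rewrite -EFinM; congr (_%:E); field.
pose U : set T := \big[setU/set0]_(i <- A) F i.
have UB : U `<=` B.
  rewrite /U big_seq; elim/big_ind: _ => // [X Y XB YB x [/XB|/YB]//|i iA [x y] [/=]].
  rewrite !in_itv/= => /andP[x1 x2] /andP[y1 y2].
  have := u1 i iA; rewrite ler_norml => /andP[u2 u3].
  have /andP[hi0 hi1] := hH i iA.
  by split => /=; rewrite in_itv/=; apply/andP; split; lra.
have m2U : m2 U = (\sum_(i <- A) h i ^+ 2 / 4)%:E.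
  rewrite /U (measure_fbigsetU m2)// big_seq -sumEFin [RHS]big_seq.
  by apply: eq_bigr => i; exact: E.
have m2UB : (m2 U <= m2 B)%E.
  by apply: le_measure => //; rewrite inE//; exact: bigsetU_measurable.
move: m2UB; rewrite m2U m2B lee_fin -mulr_suml ler_pdivrMr// mulrC; exact.
Qed.

(** Take the slopes u = p / q and h = 1 / q^2: two slopes differ by the determinant of the rows
    divided by the product of their q, so the squared difference is at least the product of the two
    h. *)
Lemma sum_quartic_unimodular (I : choiceType) (A : {fset I}) (p q : I -> R) (H : R) :
  (forall i, i \in A -> `|p i| <= `|q i|) ->
  (forall i, i \in A -> 1 <= q i ^+ 2 * H) ->
  (forall i j, i \in A -> j \in A -> i != j -> 1 <= (p i * q j - p j * q i) ^+ 2) ->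
  0 <= H ->
  \sum_(i <- A) (q i ^+ 2)^-1 ^+ 2 <= 4 * ((2 + H / 2) * H).
Proof.
move=> pq qH sep H0.
have q0 i : i \in A -> q i != 0.
  by move=> iA; apply/eqP => qi; have := qH i iA; rewrite qi expr0n/= mul0r ler10.
have q20 i : i \in A -> 0 < q i ^+ 2.
  by move=> iA; rewrite exprn_even_gt0//= q0.
apply: (@sum_sqr_separated _ _ (fun i => p i / q i)) => //.
- move=> i iA; rewrite normrM normfV ler_pdivrMr ?normr_gt0 ?q0// mul1r; exact: pq.
- move=> i iA; rewrite invr_gt0 q20//= -[_^-1]mul1r ler_pdivrMr ?q20// mulrC.
  exact: qH.
- move=> i j iA jA ij.
  have -> : p i / q i - p j / q j = (p i * q j - p j * q i) / (q i * q j).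
    by field; rewrite !q0.
  rewrite expr_div_n exprMn [leRHS]mulrC -invfM ler_peMr ?sep//.
  by rewrite invr_ge0 mulr_ge0 ?sqr_ge0.
Qed.

End packing.

(** * Shimizu's lemma for a group with a cusp of width one *)

Section shimizu.
Variable R : realType.
Implicit Types g h : 'M[R]_2.

Lemma mul22E g h i j : (g * h) i j = g i 0 * h 0 j + g i 1 * h 1 j.
Proof.
rewrite /GRing.mul/= mxE !big_ord_recl big_ord0 addr0.
by congr (_ + _ * _); congr (_ _ _); apply/val_inj.
Qed.

Lemma det22E g : \det g = g 0 0 * g 1 1 - g 0 1 * g 1 0.
Proof.
rewrite (expand_det_row _ 0) !big_ord_recl big_ord0 addr0 /cofactor !det_mx11 !mxE/=.
rewrite expr0 expr1 mul1r mulN1r mulrN.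
by congr (_ * _ - _ * _); congr (_ _ _); apply/val_inj.
Qed.

Lemma ord2P (P : 'I_2 -> Prop) : P 0 -> P 1 -> forall i, P i.
Proof.
by move=> P0 P1 [[|[|//]] p]; [have -> : Ordinal p = 0|have -> : Ordinal p = 1];
  rewrite //; exact/val_inj.
Qed.

Lemma matrix22P g h : g 0 0 = h 0 0 -> g 0 1 = h 0 1 -> g 1 0 = h 1 0 ->
  g 1 1 = h 1 1 -> g = h.
Proof. by move=> *; apply/matrixP; apply: ord2P; apply: ord2P. Qed.

Lemma inv22E g : \det g = 1 ->
  [/\ g^-1 0 0 = g 1 1, g^-1 0 1 = - g 0 1, g^-1 1 0 = - g 1 0 & g^-1 1 1 = g 0 0].
Proof.
move=> dg.
pose k : 'M[R]_2 := \matrix_(i, j) (if i == 0 then if j == 0 then g 1 1 else - g 0 1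
  else if j == 0 then - g 1 0 else g 0 0).
suff -> : g^-1 = k by rewrite !mxE.
have ug : g \is a GRing.unit by rewrite unitmxE dg unitr1.
apply: (mulrI ug); rewrite divrr//.
move: dg; rewrite det22E => dg.
by apply: matrix22P; rewrite mul22E !mxE/=; [rewrite -dg| | |rewrite -dg]; ring.
Qed.

Lemma transl00 : transl R 0 0 = 1. Proof. by rewrite mxE. Qed.
Lemma transl01 : transl R 0 1 = 1. Proof. by rewrite mxE. Qed.
Lemma transl10 : transl R 1 0 = 0. Proof. by rewrite mxE. Qed.
Lemma transl11 : transl R 1 1 = 1. Proof. by rewrite mxE. Qed.
Definition translE := (transl00, transl01, transl10, transl11).

Lemma conj_transl g : \det g = 1 -> let k := g * transl R * g^-1 in
  [/\ k 0 0 = 1 - g 0 0 * g 1 0, k 0 1 = g 0 0 ^+ 2, k 1 0 = - g 1 0 ^+ 2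
    & k 1 1 = 1 + g 0 0 * g 1 0].
Proof.
move=> dg /=; have [E1 E2 E3 E4] := inv22E dg.
move: dg; rewrite det22E => dg.
by split; rewrite !mul22E !translE ?E1 ?E2 ?E3 ?E4; have := dg; lra.
Qed.

Variable G : set 'M[R]_2.
Hypotheses (fuchsG : fuchsian G) (cuspG : cusp_oo_width1 G).

Lemma transl_in : G (transl R).
Proof.
have : stab_oo G (transl R) by rewrite cuspG; exists 1; left; rewrite expr1z.
by case.
Qed.

Fixpoint shimizu_seq g n : 'M[R]_2 :=
  if n is n'.+1 then shimizu_seq g n' * transl R * (shimizu_seq g n')^-1 else g.

Let detG g : G g -> \det g = 1. Proof. by case: fuchsG => -[+ _ _ _] _; exact. Qed.

Lemma shimizu_seq_in g n : G g -> G (shimizu_seq g n).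
Proof.
case: fuchsG => -[_ _ GM GV] _ Gg; elim: n => [//|n IH] /=.
exact: (GM _ _ (GM _ _ IH transl_in) (GV _ IH)).
Qed.

(* Shimizu's lemma: otherwise the iterated conjugates of the translation would
   converge to the translation without ever reaching it. *)
Lemma shimizu g : G g -> g 1 0 != 0 -> 1 <= `|g 1 0|.
Proof.
move=> Gg c0; rewrite leNgt; apply/negP => c1.
pose k := shimizu_seq g; pose r := `|g 1 0|.
have r0 : 0 <= r by rewrite normr_ge0.
have kS n : [/\ k n.+1 0 0 = 1 - k n 0 0 * k n 1 0, k n.+1 0 1 = k n 0 0 ^+ 2,
    k n.+1 1 0 = - k n 1 0 ^+ 2 & k n.+1 1 1 = 1 + k n 0 0 * k n 1 0].
  by apply: conj_transl; apply: detG; exact: shimizu_seq_in.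
have kn0 n : k n 1 0 != 0.
  by elim: n => [//|n IH]; have [_ _ -> _] := kS n; rewrite oppr_eq0 expf_neq0.
have kr n : `|k n 1 0| <= r ^+ n.+1.
  elim: n => [//|n IH]; have [_ _ -> _] := kS n.
  rewrite normrN normrX expr2 exprS; apply: ler_pM => //.
  by apply: (le_trans IH); rewrite exprS ler_piMr// exprn_ile1// ltW.
(* A bound preserved by a -> 1 - a c for |c| <= r: the entry 1 / (1 - r) ensures 1 + A r <= A. *)
pose A := Num.max `|g 0 0| (1 - r)^-1.
have A1 : 1 + A * r <= A.
  have : (1 - r)^-1 <= A by rewrite /A le_max lexx orbT.
  have r1 : 0 < 1 - r by rewrite subr_gt0.
  by rewrite -[X in X <= _]mul1r ler_pdivrMr//; lra.
have A0 : 0 <= A by rewrite /A le_max normr_ge0.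
have kA n : `|k n 0 0| <= A.
  elim: n => [|n IH]; first by rewrite /A le_max lexx.
  have [-> _ _ _] := kS n; apply: le_trans A1.
  rewrite (le_trans (ler_normB _ _))// normr1 lerD2l normrM ler_pM//.
  by apply: (le_trans (kr n)); rewrite exprS ler_piMr// exprn_ile1// ltW.
(* This factor dominates all entrywise errors of the conjugates: A on the diagonal, A (A + 1) at the
   upper right and 1 at the lower left. *)
have lim0 : (A * (A + 1) + 1) * r ^+ n.+1 @[n --> \oo] --> (0 : R).
  rewrite -[X in _ --> X](mulr0 (A * (A + 1) + 1)); apply: (cvgM (cvg_cst _)).
  rewrite (cvg_shiftS (fun n => r ^+ n)); apply: cvg_expr; rewrite ger0_norm//.
have [_ Giso] := fuchsG.
have [_ [V VT VG]] := Giso _ transl_in.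
have [e /= e0 eV] := (nbhs_ballP _ _).1 VT.
have [N _ /(_ N (leqnn N))] := (cvgrPdist_lt _ _).1 lim0 e e0.
rewrite /= sub0r normrN => hN.
have bnd : (A * (A + 1) + 1) * r ^+ N.+1 < e by exact: le_lt_trans (ler_norm _) hN.
have rN0 : 0 <= r ^+ N.+1 by rewrite exprn_ge0.
have rS : r ^+ N.+2 <= r ^+ N.+1 by rewrite exprS ler_piMl// ltW.
have rSS : r ^+ N.+3 <= r ^+ N.+1 by rewrite exprS (le_trans _ rS)// ler_piMl ?exprn_ge0// ltW.
have prod n : `|k n 0 0 * k n 1 0| <= A * r ^+ n.+1 by rewrite normrM ler_pM.
(* Two steps past N are taken because the upper right entry is the square of the preceding upper
   left one, which is near 1 only because the lower left entry before it is small. *)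
have kV : V (k N.+2).
  have [E1 E2 E3 E4] := kS N.+1.
  apply: eV; split => //; apply: ord2P; apply: ord2P; rewrite /ball/= !translE.
  - rewrite E1 opprB addrC subrK (le_lt_trans (prod _))//.
    nra.
  - have [E5 _ _ _] := kS N.
    have -> : 1 - k N.+2 0 1 = (1 - k N.+1 0 0) * (1 + k N.+1 0 0) by rewrite E2; ring.
    have h1 : `|1 - k N.+1 0 0| <= A * r ^+ N.+1 by rewrite E5 opprB addrC subrK.
    have h2 : `|1 + k N.+1 0 0| <= 1 + A.
      by rewrite (le_trans (ler_normD _ _))// normr1 lerD2l.
    rewrite normrM (le_lt_trans (ler_pM _ _ h1 h2))//.
    nra.
  - rewrite sub0r normrN (le_lt_trans (kr _))//.
    nra.
  - rewrite E4 opprD addrA subrr sub0r normrN (le_lt_trans (prod _))//.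
    nra.
have : (V `&` G) (k N.+2) by split => //; exact: shimizu_seq_in.
rewrite VG /= => /(congr1 (fun m : 'M[R]_2 => m 1 0)); rewrite translE.
by apply/eqP; exact: kn0.
Qed.

End shimizu.

(** * Heights along the orbit *)

Section cosets.
Variable R : realType.
Implicit Types (g h : 'M[R]_2) (tau : R[i]).

(** Q is |c tau + d|^2 for the bottom row (c, d), which is nonzero because the determinant is 1. *)
Lemma Im_moebius g tau : \det g = 1 -> 0 < complex.Im tau ->
  let Q := (g 1 0 * complex.Re tau + g 1 1) ^+ 2 + (g 1 0 * complex.Im tau) ^+ 2 in
  0 < Q /\ complex.Im (moebius g tau) = complex.Im tau / Q.
Proof.
rewrite det22E => dg tau0 /=.
have Q0 : 0 < (g 1 0 * complex.Re tau + g 1 1) ^+ 2 + (g 1 0 * complex.Im tau) ^+ 2.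
  have [c0|c0] := eqVneq (g 1 0) 0.
    rewrite c0 !mul0r add0r expr0n addr0 exprn_even_gt0//=.
    by apply/eqP => d0; move: dg; rewrite c0 d0 !mulr0 subr0 => /esym/eqP; rewrite oner_eq0.
  rewrite ltr_wpDl ?sqr_ge0// exprn_even_gt0//= mulf_neq0//; exact: lt0r_neq0.
split => //; case: tau tau0 Q0 => x y /= y0 Q0.
rewrite /moebius; simpc => /=; simpc.
rewrite -[RHS]mul1r -dg; field; exact: lt0r_neq0.
Qed.

Variable G : set 'M[R]_2.
Hypotheses (fuchsG : fuchsian G) (cuspG : cusp_oo_width1 G).
Local Notation coset := (set_type (cosets_oo G)).

Definition repr (c : coset) : 'M[R]_2 := get (val c).

Let detG g : G g -> \det g = 1. Proof. by case: fuchsG => -[+ _ _ _] _; exact. Qed.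
Let GM g h : G g -> G h -> G (g * h). Proof. by case: fuchsG => -[_ _ + _] _; exact. Qed.
Let GV g : G g -> G g^-1. Proof. by case: fuchsG => -[_ _ _ +] _; exact. Qed.

Let unitG g : G g -> g \is a GRing.unit.
Proof. by move=> Gg; rewrite unitmxE detG// unitr1. Qed.

Lemma stab_ooM g h : stab_oo G g -> stab_oo G h -> stab_oo G (g * h).
Proof.
move=> [Gg g0] [Gh h0]; split; first exact: GM.
by rewrite mul22E g0 h0 mul0r mulr0 addr0.
Qed.

Lemma stab_ooV g : stab_oo G g -> stab_oo G g^-1.
Proof.
move=> [Gg g0]; split; first exact: GV.
by have [_ _ -> _] := inv22E (detG Gg); rewrite g0 oppr0.
Qed.

Lemma reprP (c : coset) : exists2 g, G g &
  val c = [set h * g | h in stab_oo G] /\ exists2 h, stab_oo G h & repr c = h * g.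
Proof.
have /set_mem [g Gg cE] := valP c; exists g => //; split; first by rewrite -cE.
have : val c (repr c).
  apply: getPex; exists g; rewrite -cE; exists 1; last by rewrite mul1r.
  (* The chosen representative lies in the coset as soon as the coset is nonempty; this follows from
     1 being in the stabilizer, as the translation times its inverse. *)
  have st : stab_oo G (transl R) by split; [exact: transl_in|rewrite translE].
  rewrite -(divrr (unitG st.1)); apply: stab_ooM => //; exact: stab_ooV.
by rewrite -cE => -[h sh <-]; exists h.
Qed.

Lemma repr_in c : G (repr c).
Proof. by have [g Gg [_ [h [Gh _] ->]]] := reprP c; exact: GM. Qed.

Lemma coset_eq (c c' : coset) : stab_oo G (repr c' * (repr c)^-1) -> c = c'.
Proof.
have [g Gg [cE [h sh rE]]] := reprP c; have [g' Gg' [cE' [h' sh' rE']]] := reprP c'.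
move=> s; apply: val_inj; rewrite cE cE'.
have uh := unitG sh.1; have uh' := unitG sh'.1.
have e : repr c' = repr c' * (repr c)^-1 * repr c by rewrite divrK ?unitG//; exact: repr_in.
have gE' : g' = h'^-1 * (repr c' * (repr c)^-1) * h * g.
  by rewrite -[g'](mulKr uh') -rE' {1}e rE -!mulrA.
have gE : g = (h'^-1 * (repr c' * (repr c)^-1) * h)^-1 * g'.
  rewrite [in RHS]gE' mulKr//; apply: unitG.
  by apply: GM; [apply: GM; [exact: GV sh'.1|exact: s.1]|exact: sh.1].
have sk : stab_oo G (h'^-1 * (repr c' * (repr c)^-1) * h).
  by apply: stab_ooM => //; apply: stab_ooM => //; exact: stab_ooV.
apply/seteqP; split => [_ [k ks <-]|_ [k ks <-]].
  exists (k * (h'^-1 * (repr c' * (repr c)^-1) * h)^-1); last by rewrite -mulrA -gE.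
  by apply: stab_ooM => //; exact: stab_ooV.
exists (k * (h'^-1 * (repr c' * (repr c)^-1) * h)); last by rewrite gE' !mulrA.
exact: stab_ooM.
Qed.

(** Up to sign, the determinant of the two bottom rows is the lower left entry of g' g^(-1). It
    vanishes only if the cosets coincide, and otherwise Shimizu's lemma bounds it below. *)
Lemma bottom_rows_separated (c c' : coset) : c != c' ->
  1 <= (repr c 1 0 * repr c' 1 1 - repr c' 1 0 * repr c 1 1) ^+ 2.
Proof.
move=> cc'; have Gc := repr_in c; have Gc' := repr_in c'.
have Gk : G (repr c' * (repr c)^-1) by apply: GM => //; exact: GV.
have kE : (repr c' * (repr c)^-1) 1 0 =
    - (repr c 1 0 * repr c' 1 1 - repr c' 1 0 * repr c 1 1).
  rewrite mul22E; have [-> _ -> _] := inv22E (detG Gc); ring.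
have k0 : (repr c' * (repr c)^-1) 1 0 != 0.
  by apply: contra cc' => /eqP k0; apply/eqP; apply: coset_eq.
have := shimizu fuchsG cuspG Gk k0; rewrite kE normrN => h.
by rewrite -real_normK ?num_real// exprn_ege1.
Qed.

Lemma sum_Im_sqr_bounded tau (Y : R) : 0 < complex.Im tau ->
  (forall g, G g -> complex.Im (moebius g tau) < Y) ->
  exists E, forall A : {fset coset},
    \sum_(c <- A) complex.Im (moebius (repr c) tau) ^+ 2 <= E.
Proof.
move=> tau0 HY; set x := complex.Re tau; set y := complex.Im tau in tau0 *.
have Y0 : 0 < Y.
  have Gt := transl_in cuspG; have [Q0 E] := Im_moebius (detG Gt) tau0.
  by apply: lt_trans (HY _ Gt); rewrite E divr_gt0.
(* One constant for both comparisons of Q = |c tau + d|^2 with the larger entry q of the bottom row: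
   Q <= K q^2 and y^2 q^2 <= K Q. *)
pose K := 2 * (x ^+ 2 + 1 + y ^+ 2).
have x2 : 0 <= x ^+ 2 by exact: sqr_ge0.
have y2 : 0 < y ^+ 2 by rewrite exprn_gt0.
have K0 : 0 < K by rewrite /K; lra.
(* From y / Q < Y and Q <= K q^2 one gets 1 <= q^2 H; from y^2 q^2 <= K Q the height is at most (K /
   y) / q^2, whose square gives C below. *)
pose H := K * Y / y.
have H0 : 0 <= H by apply: divr_ge0; [apply: mulr_ge0|]; exact: ltW.
pose C := (K / y) ^+ 2.
have main c (q : R) : (q = repr c 1 0 /\ `|repr c 1 1| <= `|q|) \/
    (q = repr c 1 1 /\ `|repr c 1 0| <= `|q|) ->
    1 <= q ^+ 2 * H /\ complex.Im (moebius (repr c) tau) ^+ 2 <= C * (q ^+ 2)^-1 ^+ 2.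
  move=> hq; have := repr_in c; have := HY _ (repr_in c).
  move: (repr c) hq => g hq hY Gg.
  have [] := Im_moebius (detG Gg) tau0; rewrite -/x -/y; set Q := (X in 0 < X) => Q0 IE.
  have QK : Q <= K * q ^+ 2.
    have : (g 1 0) ^+ 2 <= q ^+ 2 /\ (g 1 1) ^+ 2 <= q ^+ 2.
      case: hq => -[-> h]; split => //; rewrite -[leLHS]real_normK ?num_real//;
        by rewrite -[leRHS]real_normK ?num_real// lerXn2r ?nnegrE.
    move=> [h1 h2]; rewrite /Q /K.
    have := sqr_ge0 (g 1 0 * x - g 1 1); have := ler_wpM2r x2 h1.
    have := ler_wpM2r (ltW y2) h1; nra.
  have Kq : y ^+ 2 * q ^+ 2 <= K * Q.
    have e1 : y ^+ 2 * (g 1 0) ^+ 2 <= Q by rewrite /Q; have := sqr_ge0 (g 1 0 * x + g 1 1); nra.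
    (* The difference of the two sides is a perfect square, which is the Cauchy-Schwarz defect. *)
    have e2 : y ^+ 2 * (g 1 1) ^+ 2 <= (x ^+ 2 + y ^+ 2) * Q.
      rewrite -subr_ge0.
      have -> : (x ^+ 2 + y ^+ 2) * Q - y ^+ 2 * (g 1 1) ^+ 2 =
        (g 1 0 * (x ^+ 2 + y ^+ 2) + g 1 1 * x) ^+ 2 by rewrite /Q; ring.
      exact: sqr_ge0.
    case: hq => -[-> _]; apply: (le_trans e1) || apply: (le_trans e2); rewrite /K; nra.
  have q0 : 0 < q ^+ 2 by move: QK Q0 K0 (sqr_ge0 q); nra.
  split.
    have : y < Y * Q by rewrite -ltr_pdivrMr// -IE.
    rewrite /H mulrA ler_pdivlMr// mul1r => h.
    apply: (le_trans (ltW h)); rewrite [leRHS]mulrC mulrAC [K * _]mulrC [leRHS]mulrC.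
    have := ler_wpM2l (ltW Y0) QK; lra.
  have b0 : 0 <= complex.Im (moebius g tau) by rewrite IE divr_ge0 ?ltW.
  have b1 : complex.Im (moebius g tau) <= K / y * (q ^+ 2)^-1.
    rewrite IE ler_pdivrMr//.
    have gen (k v r s : R) : k / v * r^-1 * s = k * s / (v * r) by rewrite invfM; ring.
    have yq : 0 < y * q ^+ 2 by exact: mulr_gt0.
    by rewrite gen (ler_pdivlMr _ _ yq) mulrA -expr2.
  by rewrite /C -exprMn lerXn2r ?nnegrE// (le_trans b0 b1).
exists (C * (4 * ((2 + H / 2) * H)) + C * (4 * ((2 + H / 2) * H))) => A.
(* Splitting by the larger bottom entry keeps every slope in [-1, 1], so that the packing takes
   place in a bounded box; the two halves contribute equal bounds. *)
rewrite (big_fsetID _ [pred c | `|repr c 1 1| <= `|repr c 1 0|])/=.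
apply: lerD.
- set A1 := [fset x | x in A & _]%fset.
  have A1P c : c \in A1 -> `|repr c 1 1| <= `|repr c 1 0|.
    by rewrite !inE/= => /andP[].
  apply: (@le_trans _ _ (\sum_(c <- A1) C * (repr c 1 0 ^+ 2)^-1 ^+ 2)).
    rewrite big_seq [leRHS]big_seq; apply: ler_sum => c cA.
    by have [] := main c (repr c 1 0) (or_introl (conj erefl (A1P c cA))).
  rewrite -mulr_sumr ler_wpM2l ?sqr_ge0//.
  apply: (@sum_quartic_unimodular _ _ _ (fun c => repr c 1 1)) => //.
  + move=> c cA; by have [] := main c (repr c 1 0) (or_introl (conj erefl (A1P c cA))).
  + move=> c c' cA cA' cc'; have := bottom_rows_separated cc'.
    by congr (_ <= _); ring.
- set A2 := [fset x | x in A & _]%fset.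
  have A2P c : c \in A2 -> `|repr c 1 0| <= `|repr c 1 1|.
    by rewrite !inE/= -ltNge => /andP[_ /ltW].
  apply: (@le_trans _ _ (\sum_(c <- A2) C * (repr c 1 1 ^+ 2)^-1 ^+ 2)).
    rewrite big_seq [leRHS]big_seq; apply: ler_sum => c cA.
    by have [] := main c (repr c 1 1) (or_intror (conj erefl (A2P c cA))).
  rewrite -mulr_sumr ler_wpM2l ?sqr_ge0//.
  apply: (@sum_quartic_unimodular _ _ _ (fun c => repr c 1 0)) => //.
  + move=> c cA; by have [] := main c (repr c 1 1) (or_intror (conj erefl (A2P c cA))).
  + move=> c c' cA cA' cc'; exact: bottom_rows_separated.
Qed.

End cosets.

(** * Exchange of the sums over n and over the cosets *)

Section exponential.
Variable R : realType.
Implicit Types (v w z : R[i]).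

Lemma cexpD v w : cexp (v + w) = cexp v * cexp w.
Proof.
case: v w => [a b] [c d]; rewrite /cexp/= expRD cosD sinD; simpc.
by congr (_ +i* _); ring.
Qed.

Lemma normc_cexp w : normc (cexp w) = expR (complex.Re w).
Proof.
rewrite /cexp normcM normc_real ger0_norm ?expR_ge0//.
by rewrite /normc cos2Dsin2 sqrtr1 mulr1.
Qed.

Lemma e2piD v w : e2pi (v + w) = e2pi v * e2pi w.
Proof. by rewrite /e2pi mulrDr cexpD. Qed.

Lemma normc_e2pi w : normc (e2pi w) = expR (- (2 * pi * complex.Im w)).
Proof. by rewrite /e2pi normc_cexp; case: w => x y; rewrite /= mul0r sub0r. Qed.

Lemma e2pi_neq0 w : e2pi w != 0.
Proof.
apply/eqP => w0; have := normc_e2pi w; rewrite w0 normc0 => /esym/eqP.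
by rewrite expR_eq0.
Qed.

Lemma e2pi_natM w n : e2pi (n%:R * w) = e2pi w ^+ n.
Proof.
elim: n => [|n IH]; last by rewrite -natr1 mulrDl mul1r e2piD IH exprSr.
rewrite mul0r expr0 /e2pi mulr0 /cexp /= expR0 cos0 sin0 mul1r; exact: erefl.
Qed.

Lemma e2pi_sub_imaginary z w : e2pi (z - w) =
  (expR (2 * pi * complex.Im w))%:C * e2pi (z - (complex.Re w)%:C).
Proof.
case: w => x y; rewrite -cexp_real /e2pi -cexpD; congr cexp.
by case: z => a b; apply/eqP; rewrite eq_complex /=; apply/andP; split; apply/eqP; ring.
Qed.

(** The contribution of one orbit point to the n-th term, with the factor 2 pi included. The value 0
    at n = 0 lets the majorant, which vanishes there, hold for every n; the general formula would
    involve a division by zero. *)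
Definition orbit_term z w (n : nat) : R[i] :=
  if n is 0 then 0
  else (cosh_defect (2 * pi * n%:R * complex.Im w))%:C *
       e2pi (n%:R * (z - (complex.Re w)%:C)).

Lemma orbit_termE z w n : (0 < n)%N ->
  orbit_term z w n = e2pi (z - w) ^+ n + e2pi (z - w^*%C) ^+ n -
    (e2pi (z - w) ^+ n - e2pi (z - w^*%C) ^+ n) / (n%:R * (2 * pi * complex.Im w)%:C).
Proof.
case: n => // n _; rewrite /orbit_term [e2pi (n.+1%:R * _)]e2pi_natM.
rewrite (e2pi_sub_imaginary z w) (e2pi_sub_imaginary z w^*%C).
have -> : complex.Re w^*%C = complex.Re w by case: w.
have -> : complex.Im w^*%C = - complex.Im w by case: w.
move: (e2pi (z - (complex.Re w)%:C)) => e; rewrite !exprMn.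
rewrite -!rmorphXn/= -!expRM_natr -[n.+1%:R in X in _ / X](realC_nat R).
rewrite -rmorphM/= -fmorphV/=.
rewrite (_ : 2 * pi * n.+1%:R * complex.Im w = 2 * pi * complex.Im w * n.+1%:R); last by ring.
rewrite (_ : 2 * pi * - complex.Im w * n.+1%:R = - (2 * pi * complex.Im w * n.+1%:R)); last by ring.
rewrite [n.+1%:R * (_ * _)]mulrC /cosh_defect; move: (_ * n.+1%:R) => t.
by rewrite !(rmorphB, rmorphD, rmorphM)/=; ring.
Qed.

(** Both q = e(z - w) and q' = e(z - conj w) lie in the unit disc because 0 < Im w < Im z, so each
    of the four series converges separately. *)
Lemma orbit_term_sum z w : 0 < complex.Im w < complex.Im z ->
  (fun N => \sum_(1 <= n < N) orbit_term z w n) @ \oo --> rhs_term z w.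
Proof.
move=> /andP[w0 wz].
have q1 : normc (e2pi (z - w)) < 1.
  rewrite normc_e2pi expR_lt1 oppr_lt0 !mulr_gt0 ?pi_gt0//.
  by case: z w w0 wz => [a b] [c d] /= _; rewrite subr_gt0.
have q'1 : normc (e2pi (z - w^*%C)) < 1.
  rewrite normc_e2pi expR_lt1 oppr_lt0 !mulr_gt0 ?pi_gt0//.
  by clear q1; case: z w w0 wz => [a b] [c d] /= c0 cb; lra.
set q := e2pi (z - w) in q1 *; set q' := e2pi (z - w^*%C) in q'1 *.
pose k : R[i] := ((2 * pi * complex.Im w)%:C)^-1.
rewrite (_ : (fun N => _) = fun N => \sum_(1 <= n < N) q ^+ n + \sum_(1 <= n < N) q' ^+ n
   + (- k) * (\sum_(1 <= n < N) q ^+ n / n%:R + (-1) * \sum_(1 <= n < N) q' ^+ n / n%:R)).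
  have -> : rhs_term z w = q / (1 - q) + q' / (1 - q') +
      (- k) * (- cLog (1 - q) + (-1) * - cLog (1 - q')).
    rewrite /rhs_term -/q -/q'; congr (_ + _).
    have -> : pi*i * (w - w^*%C) = - (2 * pi * complex.Im w)%:C.
      by case: (w) => x y; apply/eqP; rewrite eq_complex /=; apply/andP;
        split; apply/eqP; ring.
    by rewrite invrN -/k; ring.
  apply: cvgCD; first by apply: cvgCD; exact: cvg_geometric_series1.
  apply: cvgCZ; apply: cvgCD; first exact: cvg_log_series.
  by apply: cvgCZ; exact: cvg_log_series.
apply/funext => N; rewrite !mulr_sumr -!big_split mulr_sumr -big_split/=.
apply: eq_big_nat => n /andP[n0 _]; rewrite orbit_termE// -/q -/q' invfM -/k.
by ring.
Qed.

(** With t = 2 pi n Im w, the bound 2 t^2 exp t accounts for 8 pi^2. Replacing Im w by Y in the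
    exponential only decouples n from w. *)
Lemma normc_orbit_term z w n (Y : R) : 0 < complex.Im w <= Y ->
  normc (orbit_term z w n) <= 8 * pi ^+ 2 * (n%:R ^+ 2 *
    expR (- (2 * pi * (complex.Im z - Y) * n%:R))) * complex.Im w ^+ 2.
Proof.
case: n => [|n] /andP[w0 wY].
  by rewrite /orbit_term normc0 expr0n/= mul0r mulr0 mul0r.
have n0 : 0 < n.+1%:R :> R by rewrite ltr0n.
rewrite /orbit_term; move: (n.+1)%N n0 => {}n n0.
have t0 : 0 < 2 * pi * n%:R * complex.Im w by rewrite !mulr_gt0 ?pi_gt0.
rewrite normcM normc_real ger0_norm ?cosh_defect_ge0// normc_e2pi.
have -> : complex.Im (n%:R * (z - (complex.Re w)%:C)) = n%:R * complex.Im z.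
  by rewrite -realC_nat; case: (z) => a b; simpc => /=; ring.
apply: (le_trans (ler_wpM2r (expR_ge0 _) (cosh_defect_le t0))).
rewrite -[leLHS]mulrA -expRD.
have h : expR (2 * pi * n%:R * complex.Im w + - (2 * pi * (n%:R * complex.Im z))) <=
    expR (- (2 * pi * (complex.Im z - Y) * n%:R)).
  rewrite ler_expR -subr_ge0.
  have -> : - (2 * pi * (complex.Im z - Y) * n%:R) -
     (2 * pi * n%:R * complex.Im w + - (2 * pi * (n%:R * complex.Im z))) =
     2 * pi * n%:R * (Y - complex.Im w) by ring.
  by rewrite !mulr_ge0 ?pi_ge0 ?subr_ge0// ltW.
have c0 : 0 <= 2 * (2 * pi * n%:R * complex.Im w) ^+ 2.
  by rewrite mulr_ge0 ?sqr_ge0.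
apply: (le_trans (ler_wpM2l c0 h)); rewrite le_eqVlt; apply/orP; left; apply/eqP; ring.
Qed.

(** The Bessel denominator sqrt(2 pi t) equals 2 pi sqrt n sqrt(Im w) at t = 2 pi n Im w, which
    exactly cancels the weight 2 pi sqrt n and the factor sqrt(Im w) of the Niebur term. *)
Lemma niebur_termE (z tau : R[i]) (g : 'M[R]_2) n : (0 < n)%N ->
  0 < complex.Im (moebius g tau) ->
  orbit_term z (moebius g tau) n =
  (2 * pi)%:C * (Num.sqrt (n%:R : R))%:C * e2pi (n%:R * z) *
  niebur_term (- n%:Z) 2 tau g.
Proof.
move=> n0 w0; rewrite /niebur_term; move: (moebius g tau) w0 => w w0.
have nR : 0 < n%:R :> R by rewrite ltr0n.
have -> : `|- n%:Z|%:~R = n%:R :> R by rewrite normrN.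
have t0 : 0 < 2 * pi * n%:R * complex.Im w by rewrite !mulr_gt0 ?pi_gt0.
rewrite besselI_three_half//; case: n n0 nR t0 => // n _ nR t0; rewrite /orbit_term.
have -> : n.+1%:R * (z - (complex.Re w)%:C) =
    n.+1%:R * z + (- n.+1%:Z)%:~R * (complex.Re w)%:C.
  by rewrite mulrBr mulrNz mulNr.
rewrite e2piD.
have -> : Num.sqrt (2 * pi * (2 * pi * n.+1%:R * complex.Im w)) =
    2 * pi * Num.sqrt n.+1%:R * Num.sqrt (complex.Im w).
  have p0 : 0 <= 2 * pi :> R by rewrite mulr_ge0 ?pi_ge0.
  rewrite (_ : _ * _ = (2 * pi) ^+ 2 * (n.+1%:R * complex.Im w)); last by ring.
  by rewrite sqrtrM ?sqr_ge0// sqrtr_sqr ger0_norm// sqrtrM ?(ltW nR)// mulrA.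
have s1 : Num.sqrt n.+1%:R != 0 :> R by rewrite gt_eqF// sqrtr_gt0.
have s2 : Num.sqrt (complex.Im w) != 0 by rewrite gt_eqF// sqrtr_gt0.
have p0 : 2 * pi != 0 :> R by rewrite mulf_neq0// gt_eqF// pi_gt0.
rewrite mulrA [RHS]mulrA; congr (_ * _); rewrite [RHS]mulrAC; congr (_ * _).
rewrite -!rmorphM/=; congr (_%:C).
move: (cosh_defect (2 * pi * n.+1%:R * complex.Im w)) (2 * pi : R) p0 => D P P0.
by field; rewrite s1 s2 P0.
Qed.

(** Half of the exponential decay absorbs n^2: x^2 / 2 <= exp x at x = kappa n / 2 gives n^2 <= (8 /
    kappa^2) exp(kappa n / 2), and a geometric series remains. *)
Lemma sum_sqr_expR_bounded (kappa : R) : 0 < kappa ->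
  exists B, forall N,
    \sum_(1 <= n < N) (n%:R ^+ 2 * expR (- (kappa * n%:R))) <= B.
Proof.
move=> k0; pose rho := expR (- (kappa / 2)).
have rho1 : rho < 1 by rewrite /rho expR_lt1 oppr_lt0 divr_gt0.
have rho0 : 0 <= rho by exact: expR_ge0.
have k8 : 0 <= 8 / kappa ^+ 2 by rewrite divr_ge0 ?sqr_ge0.
exists (8 / kappa ^+ 2 * (1 - rho)^-1) => N.
apply: (@le_trans _ _ (\sum_(0 <= n < N) (8 / kappa ^+ 2 * rho ^+ n))); last first.
  rewrite -mulr_sumr ler_wpM2l// sum_geometric ?lt_eqF//.
  by rewrite ler_piMl ?invr_ge0 ?subr_ge0 ?(ltW rho1)// lerBlDr lerDl exprn_ge0.
have bnd n : n%:R ^+ 2 * expR (- (kappa * n%:R)) <= 8 / kappa ^+ 2 * rho ^+ n.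
  have x0 : 0 <= kappa / 2 * n%:R by rewrite mulr_ge0 ?divr_ge0 ?(ltW k0).
  have := expR_ge1Dxn 1 x0; have -> : (2`!)%:R = 2 :> R by [].
  move=> h.
  have -> : rho ^+ n = expR (kappa / 2 * n%:R) * expR (- (kappa * n%:R)).
    by rewrite /rho -expRM_natr -expRD; congr expR; field.
  rewrite mulrA ler_wpM2r ?expR_ge0// mulrAC ler_pdivlMr ?exprn_gt0//; lra.
case: N => [|N].
  by rewrite !big_geq.
rewrite [leRHS]big_ltn//; apply: (@le_trans _ _ (\sum_(1 <= n < N.+1) (8 / kappa ^+ 2 * rho ^+ n))).
  by apply: ler_sum => n _; exact: bnd.
by rewrite lerDr mulr_ge0 ?exprn_ge0.
Qed.

(* Only finitely many y i exceed Z / 2. *)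
Lemma square_summable_max (I : choiceType) (y : I -> R) (Z E : R) : 0 < Z ->
  (forall i, 0 <= y i < Z) ->
  (forall A : {fset I}, \sum_(i <- A) y i ^+ 2 <= E) ->
  exists2 Y, Y < Z & forall i, y i <= Y.
Proof.
move=> Z0 yZ yE.
pose S := [set \sum_(i <- (A : {fset I})) y i ^+ 2 | A in [set: {fset I}]].
have hS : has_sup S.
  split; first by exists (\sum_(i <- (fset0 : {fset I})) y i ^+ 2), fset0.
  by exists E => _ [A _ <-].
have Z2 : 0 < (Z / 2) ^+ 2 by rewrite exprn_gt0 ?divr_gt0.
(* A finite sum within (Z/2)^2 of the supremum: an index outside A with y i > Z/2 would push the sum
   beyond the supremum. *)
have [_ [A _ <-] hA] := sup_adherent Z2 hS.
have small i : i \notin A -> y i <= Z / 2.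
  move=> iA; have : y i ^+ 2 + \sum_(j <- A) y j ^+ 2 <= sup S.
    have -> : y i ^+ 2 + \sum_(j <- A) y j ^+ 2 = \sum_(j <- (i |` A)%fset) y j ^+ 2.
      by rewrite big_fsetU1.
    by apply: ub_le_sup; [case: hS|exists (i |` A)%fset].
  have /andP[yi0 _] := yZ i => h.
  rewrite -(@ler_pXn2r _ 2) ?nnegrE ?divr_ge0 ?(ltW Z0)//; lra.
have fin (s : seq I) : exists2 Y, Z / 2 <= Y < Z & forall i, i \in s -> y i <= Y.
  elim: s => [|i s [Y /andP[Y1 Y2] IH]]; first by exists (Z / 2) => //; lra.
  exists (Num.max Y (y i)).
    by rewrite le_max Y1 gt_max Y2 /=; case/andP: (yZ i).
  by move=> j; rewrite inE le_max => /predU1P[->|/IH ->//]; rewrite lexx orbT.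
have [Y /andP[Y1 Y2] HY] := fin A; exists Y => // i.
by case: (boolP (i \in A)) => [/HY//|/small]; lra.
Qed.

End exponential.

Theorem theorem1p3 (R : realType) (G : set 'M[R]_2)
    (fuchsG : fuchsian G) (firstG : first_kind G) (cuspG : cusp_oo_width1 G)
    (z tau : R[i]) (hz : 0 < complex.Im z) (htau : 0 < complex.Im tau)
    (hztau : forall g, G g -> complex.Im (moebius g tau) < complex.Im z) :
  [/\ forall n : nat, (0 < n)%N -> coset_summable G (niebur_term (- n%:Z) 2 tau),
      cvgn (fun N => \sum_(1 <= n < N) calF_term G 2 z tau n),
      coset_summable G (fun g => rhs_term z (moebius g tau))
    & calF G 2 z tau = coset_sum G (fun g => rhs_term z (moebius g tau))].
Proof.
pose w (c : set_type (cosets_oo G)) := moebius (repr c) tau.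
have w0 c : 0 < complex.Im (w c) < complex.Im z.
  have Gc := repr_in fuchsG cuspG c; rewrite hztau// andbT.
  have dc : \det (repr c) = 1 by case: fuchsG => -[+ _ _ _] _; exact.
  by have [Q0 ->] := Im_moebius dc htau; rewrite divr_gt0.
have [E hE] := sum_Im_sqr_bounded fuchsG cuspG htau hztau.
have [Y Yz wY] : exists2 Y, Y < complex.Im z & forall c, complex.Im (w c) <= Y.
  apply: square_summable_max hE => // c.
  by have /andP[/ltW -> ->] := w0 c.
have kappa0 : 0 < 2 * pi * (complex.Im z - Y) by rewrite !mulr_gt0 ?pi_gt0 ?subr_gt0.
have [B hB] := sum_sqr_expR_bounded kappa0.
pose a n c := orbit_term z (w c) n.
pose b n := 8 * pi ^+ 2 * (n%:R ^+ 2 * expR (- (2 * pi * (complex.Im z - Y) * n%:R))).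
have p8 : 0 <= 8 * pi ^+ 2 :> R by rewrite mulr_ge0 ?sqr_ge0.
have b0 n : 0 <= b n.
  by apply: mulr_ge0 => //; apply: mulr_ge0.
have ab n c : normc (a n c) <= b n * complex.Im (w c) ^+ 2.
  by apply: normc_orbit_term; rewrite wY andbT; case/andP: (w0 c).
have bB N : \sum_(1 <= n < N) b n <= 8 * pi ^+ 2 * B.
  by rewrite -mulr_sumr ler_wpM2l.
have e0 c : 0 <= complex.Im (w c) ^+ 2 by exact: sqr_ge0.
have aS c : (fun N => \sum_(1 <= n < N) a n c) @ \oo --> rhs_term z (w c).
  exact: orbit_term_sum.
(* The factor between [orbit_term] and the Niebur term. It is nonzero for n > 0, so summability and
   sums pass back from the former to the latter. *)
pose K n : R[i] := (2 * pi)%:C * (Num.sqrt (n%:R : R))%:C * e2pi (n%:R * z).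
have p0 : (2 * pi : R)%:C != 0 by rewrite fmorph_eq0 mulf_neq0// gt_eqF// pi_gt0.
have s0 n : (0 < n)%N -> (Num.sqrt (n%:R : R))%:C != 0.
  by move=> n0; rewrite fmorph_eq0 gt_eqF// sqrtr_gt0 ltr0n.
have K0 n : (0 < n)%N -> K n != 0.
  move=> n0; apply: mulf_neq0; last exact: e2pi_neq0.
  exact: mulf_neq0 (s0 n n0).
have nieburE n : (0 < n)%N ->
    on_cosets (niebur_term (- n%:Z) 2 tau) =
    (fun c => (K n)^-1 * a n c) :> (set_type (cosets_oo G) -> _).
  move=> n0; apply/funext => c; rewrite /a niebur_termE//; last by case/andP: (w0 c).
  by rewrite mulKf// K0.
have summ_a n := summable_term b0 ab hE n.
have summ_niebur n : (0 < n)%N -> coset_summable G (niebur_term (- n%:Z) 2 tau).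
  move=> n0; rewrite /coset_summable nieburE//.
  apply/cvg_ex; eexists; apply: cvg_partial_sumZ; exact: summ_a.
(* The inverse of 2 pi appears because [orbit_term] contains this factor, whereas [calF] puts it in
   front of the limit. *)
have limF : (fun N => \sum_(1 <= n < N) calF_term G 2 z tau n) @ \oo -->
    (2 * pi)%:C^-1 * coset_sum G (fun g => rhs_term z (moebius g tau)).
  rewrite (_ : (fun N => _) = fun N => (2 * pi)%:C^-1 *
      \sum_(1 <= n < N) lim (summability.partial_sum (a n) @ summability.totally)).
    apply: cvgCZ; exact: (exchange_sums b0 e0 ab bB hE aS).
  apply/funext => N; rewrite mulr_sumr; apply: eq_big_nat => n /andP[n0 _].
  rewrite /calF_term /niebur /coset_sum nieburE// lim_partial_sumZ; last exact: summ_a.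
  rewrite /K; move: (lim _) (_%:C) (_%:C) (e2pi _) p0 (s0 n n0) (e2pi_neq0 (n%:R * z)).
  move=> L s p q p0' s0' q0'.
  by field; rewrite s0' p0' q0'.
split.
- exact: summ_niebur.
- by apply/cvg_ex; eexists; exact: limF.
- exact: (summable_limit b0 e0 ab bB hE aS).
- by rewrite /calF (cvgC_lim limF) mulVKf.
Qed.
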